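(* Let $\beta\ge 2$, let $k\ge 0$ be an integer, and let $\alpha,L,L_f,G,G_g,\bar L>0$ be given constants. Let $T\ge 1$ be an integer and consider the projected stochastic gradient algorithm $$x_{t+1}=\Pi_\Theta\bigl(x_t-\eta_t\,\tilde g_t\bigr),\qquad t=0,1,\dots,T-1,$$ where $\tilde g_t$ is the kernel-based gradient estimator defined in the context, with step size $\eta_t=\gamma/(t+t_0)$, where $\gamma\ge 4/\alpha$ and $t_0\ge\alpha\gamma$, and with smoothing parameter $h=\min\bigl(\kappa\,T^{-1/(2(\beta+k))},1\bigr)$ for some $\kappa>0$. Set $N=2dT$ (the total number of queries). Then, for any initialization $x_0\in\Theta$, $$\sup_{g\in\mathcal F'_{\alpha,\beta,k}(L,L_f,G,G_g,\bar L)}\mathbb E\bigl[f(x_T)-f(x^\star)\bigr]\le C\,d^{(2\beta+k-1)/(\beta+k)}\,N^{-(\beta-1)/(\beta+k)},$$ where $f=\partial_j^k g$, $x^\star$ is the minimizer of $f$ on $\Theta$, and $C>0$ is a constant depending only on $\alpha,\gamma,t_0,\kappa,L_f,G,R,C_{\mathrm{bias}},C_{\mathrm{var}}$ (and on the fixed $\beta,k$), and independent of $N$ and $d$.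
   Context: **General notation.** $\|\cdot\|$ and $\langle\cdot,\cdot\rangle$ are the Euclidean norm and inner product on $\mathbb R^d$. $\Theta\subset\mathbb R^d$ is a compact convex set with non-empty interior, $\Pi_\Theta$ is the Euclidean projection onto $\Theta$, $R:=\sup_{x,y\in\Theta}\|x-y\|$, and $\Theta^+:=\{x\in\mathbb R^d:\mathrm{dist}(x,\Theta)\le 1\}$. A coordinate $j\in\{1,\dots,d\}$ is fixed; $e_l$ is the $l$-th canonical basis vector; $\partial_j^k$ is the $k$-th order partial derivative in the $j$-th coordinate, with $\partial_j^0 g:=g$. $\lfloor\beta\rfloor$ denotes the largest integer strictly less than $\beta$. **Hölder class.** For $\beta,L>0$ and $\ell=\lfloor\beta\rfloor$, $\mathcal F_\beta(L)$ is the set of functions $\phi:\mathbb R^d\to\mathbb R$ that are $\ell$ times continuously differentiable and satisfy $\bigl|\phi(z)-\sum_{|m|\le\ell}\frac1{m!}D^m\phi(x)(z-x)^m\bigr|\le L\|z-x\|^\beta$ for all $x,z\in\mathbb R^d$ ($m$ multi-index). **Strong convexity.** A continuously differentiable $f$ is $\alpha$-strongly convex on a convex set $S$ if $f(y)\ge f(x)+\langle\nabla f(x),y-x\rangle+\frac\alpha2\|y-x\|^2$ for all $x,y\in S$. **Function class.** For $\beta>1$, $\mathcal F'_{\alpha,\beta,k}(L,L_f,G,G_g,\bar L)$ is the set of $g:\mathbb R^d\to\mathbb R$ such that, with $f:=\partial_j^k g$: (a) $g\in\mathcal F_{\beta+k}(L)$; (b) $f$ is $\alpha$-strongly convex on $\Theta$;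 (c) $\nabla f$ is $L_f$-Lipschitz on $\Theta$; (d) $\|\nabla f(x)\|\le G$ for all $x\in\Theta$; (e) $\|\nabla g(x)\|\le G_g$ for all $x\in\Theta^+$; (f) $\nabla g$ is $\bar L$-Lipschitz on $\Theta^+$; (g) $f$ attains its minimum on $\Theta$ at a point $x^\star\in\mathrm{int}(\Theta)$ (unique by (b)). **Kernels.** Let $\ell_*:=\lfloor\beta+k\rfloor$. Two fixed bounded kernels $K_k,K_1:[-1/2,1/2]\to\mathbb R$ are given (chosen separately, also when $k=1$) such that $\int u^aK_k(u)\,du=0$ for $a\in\{0,\dots,\ell_*\}\setminus\{k\}$ and $\int u^kK_k(u)\,du=k!$; and $\int v^bK_1(v)\,dv=0$ for $b=0$ and for all odd $b$ with $3\le b\le\ell_*$, and $\int vK_1(v)\,dv=1$. **Oracle and gradient estimator.** At step $t\in\{0,\dots,T-1\}$, for each $l\in\{1,\dots,d\}$, one observes $$y^{\pm}_{t,l}=g(x_t+hU_{t,l}e_j\pm hV_{t,l}e_l)+\varepsilon^{\pm}_{t,l},$$ where all $U_{t,l},V_{t,l}$ are i.i.d. uniform on $[-1/2,1/2]$, the noises satisfy $\mathbb E[(\varepsilon^\pm_{t,l})^2]\le\sigma^2$, and the collection of all randomization variables $(U_{t,l},V_{t,l})_{t,l}$ is independent of the collection of all noise variables $(\varepsilon^\pm_{t,l})_{t,l}$. No independence among the noises and no zero-mean property is assumed. The estimator is $\tilde g_t=(\tilde g_{t,1},\dots,\tilde g_{t,d})$ with $$\tilde g_{t,l}:=\frac{K_k(U_{t,l})K_1(V_{t,l})}{2h^{k+1}}\bigl(y^+_{t,l}-y^-_{t,l}\bigr).$$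 **Constants.** With $U,V$ uniform on $[-1/2,1/2]$, $C_{\mathrm{bias}}:=L\,(\mathbb E[K_k(U)^2])^{1/2}(\mathbb E[K_1(V)^2])^{1/2}$ and $C_{\mathrm{var}}:=\frac{\mathbb E[K_k(U)^2]\,\mathbb E[K_1(V)^2]}{4}\bigl(\frac{3\bar L^2}{16}+6G_g^2+8\sigma^2\bigr)$. *)

(* Defs.v *)
From HB Require Import structures.
From mathcomp Require Import all_boot all_order all_algebra.
From mathcomp Require Import all_classical all_reals all_analysis.

Set Implicit Arguments.
Unset Strict Implicit.
Unset Printing Implicit Defensive.

Import Order.TTheory GRing.Theory Num.Theory.
Import numFieldNormedType.Exports.

Local Open Scope classical_set_scope.
Local Open Scope ring_scope.

Section Euclidean.
Variables (R : realType) (d : nat).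
Implicit Types (x y : 'rV[R]_d) (S : set 'rV[R]_d).

Definition dotv x y : R := \sum_(i < d) x 0 i * y 0 i.

(* The library norm on 'rV[R]_d is the sup norm. It induces the same topology
   as the Euclidean norm, so [compact], [interior] and [continuous] are the
   library ones, but all distances are measured with [enorm]. *)
Definition enorm x : R := Num.sqrt (dotv x x).

Definition dist x S : R := inf [set enorm (x - y) | y in S].

Definition diameter S : R := sup [set enorm (x - y) | x in S & y in S].

Definition fattening S : set 'rV[R]_d := [set x | dist x S <= 1].

Definition argmin (f : 'rV[R]_d -> R) S : 'rV[R]_d :=
  xget 0 [set x | S x /\ forall y, S y -> f x <= f y].

Definition proj S x : 'rV[R]_d := argmin (fun y => enorm (x - y)) S.

Definition lipschitz_with (c : R) (F : 'rV[R]_d -> 'rV[R]_d) S : Prop :=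
  forall x y, S x -> S y -> enorm (F x - F y) <= c * enorm (x - y).

End Euclidean.

Section Smoothness.
Variables (R : realType) (d : nat).
Implicit Types (f g : 'rV[R]_d -> R) (i j : 'I_d) (x y z : 'rV[R]_d).

Definition unitv i : 'rV[R]_d := delta_mx 0 i.

Definition pd i g : 'rV[R]_d -> R := fun x => 'D_(unitv i) g x.

Definition pd_seq (s : seq 'I_d) g : 'rV[R]_d -> R := foldr pd g s.

Definition pdn (k : nat) j g : 'rV[R]_d -> R := iter k (pd j) g.

Definition grad f x : 'rV[R]_d := \row_i pd i f x.

Definition Cn (l : nat) g : Prop :=
  forall s : seq 'I_d, (size s <= l)%N ->
    continuous (pd_seq s g) /\
    ((size s < l)%N -> forall i x, derivable (pd_seq s g) x (unitv i)).

(* Multi-indices of order at most [l] all have entries at most [l], so they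
   are encoded as finite functions into 'I_l.+1 with bounded sum. *)
Definition mindex (l : nat) : Type := {ffun 'I_d -> 'I_l.+1}.

Definition Dmulti l (m : mindex l) g : 'rV[R]_d -> R :=
  foldr (fun i h => pdn (m i) i h) g (enum 'I_d).

Definition taylor (l : nat) g x z : R :=
  \sum_(m : {ffun 'I_d -> 'I_l.+1} | (\sum_i m i <= l)%N)
    (\prod_i (m i)`!)%N%:R^-1 * Dmulti m g x * \prod_i (z - x) 0 i ^+ m i.

(* The largest integer strictly less than [b], for [b > 0]. *)
Definition sfloor (b : R) : nat := `|Num.ceil b - 1|%N.

Lemma sfloorP (b : R) : 0 < b -> (sfloor b)%:R < b <= (sfloor b).+1%:R.
Proof.
move=> b0; have c0 : 0 <= Num.ceil b - 1.
  by rewrite subr_ge0 -gtz0_ge1 ceil_gt0.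
have e : (sfloor b)%:R = (Num.ceil b - 1)%:~R :> R.
  by rewrite /sfloor -[in RHS](gez0_abs c0).
by rewrite -addn1 natrD e -(intrD _ _ 1) subrK; exact: ceil_itv.
Qed.

Definition holder (beta L : R) g : Prop :=
  Cn (sfloor beta) g /\
  forall x z, `|g z - taylor (sfloor beta) g x z| <= L * enorm (z - x) `^ beta.

Definition strongly_convex (alpha : R) f (S : set 'rV[R]_d) : Prop :=
  forall x y, S x -> S y ->
    f x + dotv (grad f x) (y - x) + alpha / 2 * enorm (y - x) ^+ 2 <= f y.

(* Continuous differentiability of [pdn k j g] is implied by [fc_holder],
   since [sfloor (beta + k) >= k + 1] when [beta > 1]. *)
Record fclass (Theta : set 'rV[R]_d) j (alpha beta : R) (k : nat)
    (L Lf G Gg Lbar : R) g : Prop := {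
  fc_holder : holder (beta + k%:R) L g;
  fc_convex : strongly_convex alpha (pdn k j g) Theta;
  fc_grad_lip : lipschitz_with Lf (grad (pdn k j g)) Theta;
  fc_grad_bound : forall x, Theta x -> enorm (grad (pdn k j g) x) <= G;
  fc_ggrad_bound : forall x, fattening Theta x -> enorm (grad g x) <= Gg;
  fc_ggrad_lip : lipschitz_with Lbar (grad g) (fattening Theta);
  fc_min : exists2 xs, (interior Theta) xs &
             forall y, Theta y -> pdn k j g xs <= pdn k j g y }.

End Smoothness.

Section Kernels.
Variable R : realType.
Implicit Types K : R -> R.

Definition kitv : set R := `[- 2^-1, 2^-1].

Lemma kitv_lt : - 2^-1 < 2^-1 :> R.
Proof. by rewrite gtrN // invr_gt0. Qed.

Definition unif : probability (measurableTypeR R) R := uniform_prob kitv_lt.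

(* A kernel is a function on [kitv]: it is given as a function on R whose
   values outside [kitv] are irrelevant, and evaluated through its extension
   by zero. *)
Definition kext K : R -> R := K \_ kitv.

Definition bounded_kernel K : Prop :=
  measurable_fun kitv K /\ exists M : R, forall u, kitv u -> `|K u| <= M.

Definition kmoment K (a : nat) : R :=
  \int[lebesgue_measure]_(u in kitv) (u ^+ a * K u).

Definition kernel_k (l k : nat) K : Prop :=
  [/\ bounded_kernel K,
      forall a, (a <= l)%N -> a <> k -> kmoment K a = 0
    & kmoment K k = k`!%:R].

Definition kernel_1 (l : nat) K : Prop :=
  [/\ bounded_kernel K,
      kmoment K 0 = 0,
      forall b, (3 <= b <= l)%N -> odd b -> kmoment K b = 0
    & kmoment K 1 = 1].

Definition ksq K : R := fine 'E_unif[fun u => kext K u ^+ 2].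

Definition Cbias (L : R) Kk K1 : R :=
  L * Num.sqrt (ksq Kk) * Num.sqrt (ksq K1).

Definition Cvar (Lbar Gg sigma : R) Kk K1 : R :=
  ksq Kk * ksq K1 / 4 *
  (3 * Lbar ^+ 2 / 16 + 6 * Gg ^+ 2 + 8 * sigma ^+ 2).

End Kernels.

Section Probability.
Context {R : realType} {dO : measure_display} {Omega : measurableType dO}.
Variable P : probability Omega R.

Definition mutually_independent (I : finType) (X : I -> {RV P >-> R}) : Prop :=
  forall (J : {set I}) (B : I -> set R),
    (forall i, i \in J -> measurable (B i)) ->
    (P (\bigcap_(i in [set` J]) (X i @^-1` B i)) =
     \prod_(i in J) P (X i @^-1` B i))%E.

Definition sigma_rv (I : Type) (X : I -> {RV P >-> R}) : set (set Omega) :=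
  <<s [set A | exists i B, measurable B /\ A = X i @^-1` B] >>.

Definition independent_families (I J : Type)
    (X : I -> {RV P >-> R}) (Y : J -> {RV P >-> R}) : Prop :=
  forall A B, sigma_rv X A -> sigma_rv Y B ->
    (P (A `&` B) = P A * P B)%E.

Definition uniform_rv (X : {RV P >-> R}) : Prop :=
  forall A, measurable A -> distribution P X A = unif R A.

Definition family2 (T d : nat) (X Y : nat -> 'I_d -> {RV P >-> R})
    (i : ('I_T * 'I_d) + ('I_T * 'I_d)) : {RV P >-> R} :=
  match i with
  | inl p => X p.1 p.2
  | inr p => Y p.1 p.2
  end.

(* Variables are indexed by all [t : nat]; only those with [t < T] are
   constrained, and only those enter the first [T] steps. *)
Definition oracle_model (T d : nat) (sigma : R)
    (U V ep em : nat -> 'I_d -> {RV P >-> R}) : Prop :=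
  [/\ forall t l, (t < T)%N -> uniform_rv (U t l) /\ uniform_rv (V t l),
      mutually_independent (@family2 T d U V),
      forall t l, (t < T)%N ->
        ('E_P[(fun w => ep t l w ^+ 2)%R] <= ((sigma ^+ 2)%R)%:E)%E /\
        ('E_P[(fun w => em t l w ^+ 2)%R] <= ((sigma ^+ 2)%R)%:E)%E
    & independent_families (@family2 T d U V) (@family2 T d ep em)].

End Probability.

Section Algorithm.
Variables (R : realType) (d : nat).

Definition estimator (g : 'rV[R]_d -> R) (j : 'I_d) (k : nat) (h : R)
    (Kk K1 : R -> R) (x : 'rV[R]_d) (u v ep em : 'I_d -> R) : 'rV[R]_d :=
  \row_l
    let yp := g (x + (h * u l) *: unitv R j + (h * v l) *: unitv R l) + ep l in
    let ym := g (x + (h * u l) *: unitv R j - (h * v l) *: unitv R l) + em l in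
    kext Kk (u l) * kext K1 (v l) / (2 * h ^+ k.+1) * (yp - ym).

Fixpoint psgd (Omega : Type) (Theta : set 'rV[R]_d) (g : 'rV[R]_d -> R)
    (j : 'I_d) (k : nat) (h : R) (eta : nat -> R) (Kk K1 : R -> R)
    (U V ep em : nat -> 'I_d -> Omega -> R) (x0 : 'rV[R]_d)
    (t : nat) (w : Omega) : 'rV[R]_d :=
  if t is s.+1 then
    let x := psgd Theta g j k h eta Kk K1 U V ep em x0 s w in
    proj Theta (x - eta s *:
      estimator g j k h Kk K1 x (U s ^~ w) (V s ^~ w) (ep s ^~ w) (em s ^~ w))
  else x0.

Definition step_size (gamma t0 : R) (t : nat) : R := gamma / (t%:R + t0).

Definition bandwidth (kappa beta : R) (k T : nat) : R :=
  Num.min (kappa * T%:R `^ (- (2 * (beta + k%:R))^-1)) 1.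

End Algorithm.

(* Main.v *)
(** Put D(t) = E |x_t - xs|^2, xs being the minimizer. The pairs (U_{t,l}, V_{t,l})
    are uniform and independent of the past and of all the noise, so expectations
    over them are computed with the query point and the noise frozen. After a Taylor expansion
    of g, the moment conditions kill every monomial of the difference of the two
    queries except the one that carries d_l d_j^k g, and they kill the noise since
    K_1 has mean zero: the bias is at most B = Cbias h^(beta - 1) per coordinate.
    The mean value theorem bounds the second moment by V = Cvar h^(- 2 (k + 1)).
    Projections are contractions and <grad f(x), x - xs> >= alpha |x - xs|^2, so
      D(t+1) <= (1 - eta_t alpha) D(t) + eta_t d B^2 / alpha + eta_t^2 d V,
    whence D(T) <= d B^2 / alpha^2 + (t0 R^2 + gamma^2 d V) / (T + t0) by induction.
    Finally f(x) - f(xs) <= L_f |x - xs|^2 because the gradient of f vanishes at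
    the interior minimizer, and the bandwidth h balances the two terms. *)

Require Import Defs.
From HB Require Import structures.
From mathcomp Require Import all_boot all_order all_algebra.
From mathcomp Require Import all_classical all_reals all_analysis.
From mathcomp Require Import measurable_realfun ring lra.

Set Implicit Arguments.
Unset Strict Implicit.
Unset Printing Implicit Defensive.

Import Order.TTheory GRing.Theory Num.Theory.
Import numFieldNormedType.Exports.

Local Open Scope classical_set_scope.
Local Open Scope ring_scope.

(** * Euclidean geometry and projections *)

(** The noise may be biased and dependent across steps, so there is no martingale structure in time
    to rely on. What gets frozen is all the noise, future noise included, together with the earlier
    randomization: the current iterate and noise are measurable for that sigma-algebra, the current
    pair is independent of it, and Fubini on a product law takes the place of conditional
    expectation. The squared distance splits over coordinates, so each pair is integrated on its own
    against one common history. The two queries are symmetric in the direction $e_l$, which cancels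
    every monomial even in $V$; this is why $K_1$ carries conditions only on its zeroth and odd
    moments. When $l=j$ the two displacements add up and a binomial expansion is required. The
    multi-index derivative is taken in the order of the coordinates, so identifying it with
    $\partial_l\partial_j^k g$ calls for the symmetry of mixed partials. The noise has only second
    moments, so increments are dominated by an integrable function of the squared noise instead of
    being bounded. *)

Section EuclideanGeometry.
Variables (R : realType) (d : nat).
Implicit Types (x y z : 'rV[R]_d) (S : set 'rV[R]_d).

Lemma dotvC x y : dotv x y = dotv y x.
Proof. by apply: eq_bigr => i _; rewrite mulrC. Qed.

Lemma dotvDl x y z : dotv (x + y) z = dotv x z + dotv y z.
Proof. by rewrite /dotv -big_split; apply: eq_bigr => i _; rewrite mxE mulrDl. Qed.

Lemma dotvZl c x y : dotv (c *: x) y = c * dotv x y.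
Proof. by rewrite /dotv mulr_sumr; apply: eq_bigr => i _; rewrite mxE mulrA. Qed.

Lemma dotvNl x y : dotv (- x) y = - dotv x y.
Proof. by rewrite -scaleN1r dotvZl mulN1r. Qed.

Lemma dotvDr x y z : dotv x (y + z) = dotv x y + dotv x z.
Proof. by rewrite !(dotvC x) dotvDl. Qed.

Lemma dotvZr c x y : dotv x (c *: y) = c * dotv x y.
Proof. by rewrite !(dotvC x) dotvZl. Qed.

Lemma dotvNr x y : dotv x (- y) = - dotv x y.
Proof. by rewrite !(dotvC x) dotvNl. Qed.

Lemma dotv_ge0 x : 0 <= dotv x x.
Proof. by apply: sumr_ge0 => i _; rewrite -expr2 sqr_ge0. Qed.

Lemma enorm_sqr x : enorm x ^+ 2 = dotv x x.
Proof. by rewrite sqr_sqrtr// dotv_ge0. Qed.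

Lemma enorm_ge0 x : 0 <= enorm x.
Proof. exact: sqrtr_ge0. Qed.

Lemma dotvBB x y : dotv (x - y) (x - y) = dotv x x - 2 * dotv x y + dotv y y.
Proof.
by rewrite !(dotvDl, dotvDr, dotvNl, dotvNr) (dotvC y x); ring.
Qed.

Lemma dotv_distC x y : dotv (x - y) (x - y) = dotv (y - x) (y - x).
Proof. by rewrite -opprB dotvNl dotvNr opprK. Qed.

Lemma dotv_eq0 x : dotv x x = 0 -> x = 0.
Proof.
move=> /eqP; rewrite psumr_eq0; last by move=> i _; rewrite -expr2 sqr_ge0.
move=> /allP x0; apply/rowP => i; rewrite mxE.
by have := x0 i (mem_index_enum i); rewrite /= mulf_eq0 orbb => /eqP.
Qed.

(** Together with [norm_le_enorm] this compares the two norms, so that continuity and boundedness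
    for the sup norm can enter Euclidean estimates. *)
Lemma dotv_le_norm x : dotv x x <= d%:R * `|x| ^+ 2.
Proof.
rewrite /dotv (le_trans (@ler_sum _ _ _ _ _ (fun=> `|x| ^+ 2) _)) //.
  move=> i _; rewrite -expr2 -real_normK ?num_real// ler_sqr ?nnegrE//.
  rewrite [leRHS]mx_normrE.
  by apply: (le_bigmax _ (fun k : 'I_1 * 'I_d => `|x k.1 k.2|) (ord0, i)).
by rewrite sumr_const card_ord mulr_natl.
Qed.

Lemma coord_le_enorm x i : `|x 0 i| <= enorm x.
Proof.
rewrite -ler_sqr ?nnegrE ?enorm_ge0// enorm_sqr real_normK ?num_real//.
rewrite /dotv (bigD1 i)//= -expr2 lerDl.
by apply: sumr_ge0 => k _; rewrite -expr2 sqr_ge0.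
Qed.

Lemma norm_le_enorm x : `|x| <= enorm x.
Proof.
rewrite [`|x|]mx_normrE; apply: bigmax_le => [|[i j] _ /=]; first exact: enorm_ge0.
by rewrite (ord1 i); exact: coord_le_enorm.
Qed.

Lemma continuous_dotv_dist x : continuous (fun y => dotv (x - y) (x - y)).
Proof.
apply: (@continuous_big R 'I_d +%R 0 xpredT (@add_continuous R^o) _ _
  (fun i (y : 'rV[R]_d) => (x - y) 0 i * (x - y) 0 i)) => i _ y.
have c : {for y, continuous (fun y : 'rV[R]_d => (x - y) 0 i)}.
  apply: (@continuous_comp _ _ _ (fun y => x - y)
    (fun z : 'rV[R]_d => z 0 i)); last exact: coord_continuous.
  by apply: continuousB => //; exact: cst_continuous.
exact: (continuousM c c).
Qed.

Lemma argminP (f : 'rV[R]_d -> R) S :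
  (exists2 x, S x & forall y, S y -> f x <= f y) ->
  S (argmin f S) /\ forall y, S y -> f (argmin f S) <= f y.
Proof.
case=> x Sx fx; apply: (@xgetPex _ 0 [set x | S x /\ forall y, S y -> f x <= f y]).
by exists x.
Qed.

(** Compactness is applied to the squared distance, a polynomial in the coordinates; monotonicity of
    the square root returns to [enorm]. *)
Lemma proj_argmin S (x : 'rV[R]_d) : compact S -> S !=set0 ->
  S (Defs.proj S x) /\ forall y, S y -> enorm (x - Defs.proj S x) <= enorm (x - y).
Proof.
move=> cS S0; apply: argminP.
have [|p pS hp] := @compact_EVT_min _ _ (fun y => dotv (x - y) (x - y)) _ S0 cS.
  by apply: continuous_subspaceT; exact: continuous_dotv_dist.
exists p; first exact: set_mem.
by move=> y Sy; apply: ler_wsqrtr; apply: hp; rewrite inE.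
Qed.

Lemma convex_segment S (x y : 'rV[R]_d) (s : R) : convex_set S -> S x -> S y ->
  0 <= s <= 1 -> S (x + s *: (y - x)).
Proof.
move=> cS Sx Sy /andP[s0 s1].
have := cS y x (Itv01 s0 s1); rewrite !inE => /(_ Sy Sx).
by congr (S _); rewrite /conv/= /isConvexSpace.conv/= scalerBr scalerBl scale1r addrCA.
Qed.

(** Moving from the projection $p$ a fraction $s$ of the way to $z$ stays in the set by convexity
    and cannot reduce the distance to $x$; expanding the square and dividing by $s$ leaves $2\langle
    x-p,z-p\rangle\le s\|z-p\|^2$ for all $0<s\le1$. *)
Lemma proj_obtuse S (x z : 'rV[R]_d) : compact S -> convex_set S -> S z ->
  dotv (x - Defs.proj S x) (z - Defs.proj S x) <= 0.
Proof.
move=> cS vS Sz; have S0 : S !=set0 by exists z.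
have [Sp hp] := proj_argmin x cS S0.
set p := Defs.proj S x in Sp hp *; rewrite leNgt; apply/negP => c0.
set c := dotv _ _ in c0; set n := dotv (z - p) (z - p).
have n0 : 0 <= n by exact: dotv_ge0.
have key (s : R) : 0 < s <= 1 -> 2 * c <= s * n.
  move=> /andP[s0 s1].
  have Sq : S (p + s *: (z - p)) by apply: convex_segment => //; rewrite ltW.
  have := hp _ Sq; rewrite -ler_sqr ?nnegrE ?enorm_ge0// !enorm_sqr.
  rewrite opprD addrA [X in _ <= X]dotvBB dotvZl !dotvZr -/n -/c => h.
  suff : 0 <= s * (s * n - 2 * c) by rewrite pmulr_rge0// subr_ge0.
  lra.
(* This choice of $s$ gives $sn\le cn/(n+1)<2c$, against [key]; the $+1$ keeps the denominator
   positive when $n=0$. *)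
have : 2 * c <= Num.min 1 (c / (n + 1)) * n.
  apply: key; rewrite lt_min ltr01 ge_min lexx/= andbT.
  by rewrite divr_gt0// ltr_wpDl.
apply/negP; rewrite -ltNge.
have : Num.min 1 (c / (n + 1)) * n <= c / (n + 1) * n.
  by rewrite ler_wpM2r// ge_min lexx orbT.
move=> /le_lt_trans; apply.
have n1 : 0 < n + 1 by rewrite ltr_wpDl.
rewrite mulrAC ltr_pdivrMr//; nra.
Qed.

Lemma proj_contract S (x z : 'rV[R]_d) : compact S -> convex_set S -> S z ->
  dotv (Defs.proj S x - z) (Defs.proj S x - z) <= dotv (x - z) (x - z).
Proof.
move=> cS vS Sz; have := proj_obtuse x cS vS Sz; set p := Defs.proj S x => h.
have -> : x - z = (x - p) - (z - p) by rewrite opprB addrA subrK.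
rewrite [X in _ <= X]dotvBB (dotv_distC p z); have := dotv_ge0 (x - p); lra.
Qed.

(** Adding the two obtuse-angle inequalities gives $\|p-q\|^2\le\langle x-y,p-q\rangle$. It serves
    to make the projection continuous, hence the iterates measurable. *)
Lemma proj_nonexpansive S (x y : 'rV[R]_d) : compact S -> convex_set S -> S !=set0 ->
  dotv (Defs.proj S x - Defs.proj S y) (Defs.proj S x - Defs.proj S y) <= dotv (x - y) (x - y).
Proof.
move=> cS vS S0.
have [Sp _] := proj_argmin x cS S0; have [Sq _] := proj_argmin y cS S0.
have := proj_obtuse x cS vS Sq; have := proj_obtuse y cS vS Sp.
set p := Defs.proj S x; set q := Defs.proj S y => h1 h2.
have := dotv_ge0 ((x - y) - (p - q)); rewrite dotvBB.
have : dotv (p - q) (p - q) <= dotv (x - y) (p - q).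
  have -> : x - y = (x - p) + (p - q) - (y - q).
    by rewrite addrA subrK opprB addrA subrK.
  rewrite (dotvDl _ (- (y - q))) (dotvDl (x - p)) (dotvNl (y - q)).
  move: h1 h2; rewrite -(opprB p q) dotvNr.
  move: (dotv (y - q) _) (dotv (x - p) _) (dotv (p - q) _) => a b c; lra.
move: (dotv _ _) (dotv _ _) (dotv _ _) => a b c; lra.
Qed.

Lemma continuous_proj S : compact S -> convex_set S -> S !=set0 ->
  continuous (Defs.proj S).
Proof.
move=> cS vS S0 x; apply/(@cvgrPdist_lt _ _ _ (nbhs x)) => e e0.
near=> y.
have /(le_lt_trans (norm_le_enorm _)) -> // : enorm (Defs.proj S x - Defs.proj S y) < e.
rewrite -ltr_sqr ?nnegrE ?enorm_ge0 ?ltW// enorm_sqr.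
apply: le_lt_trans (proj_nonexpansive _ _ _ _ _) _ => //.
apply: le_lt_trans (dotv_le_norm _) _.
have d1 : 0 < d%:R + 1 :> R by rewrite ltr_wpDl.
(* The factor $d+1$ works because $d\le(d+1)^2$, and it is nonzero for $d=0$ too. *)
have : `|x - y| < e / (d%:R + 1).
  by near: y; apply: cvgr_dist_lt; [exact: cvg_id|rewrite divr_gt0].
rewrite ltr_pdivlMr// => h.
have n0 := normr_ge0 (x - y); have dn := ler0n R d.
move: `|x - y| (d%:R : R) n0 dn d1 h => a b a0 b0 b1 h.
have : (a * (b + 1)) ^+ 2 < e ^+ 2
  by rewrite ltr_sqr// nnegrE; [exact: mulr_ge0 a0 (ltW b1)|exact: ltW].
apply: le_lt_trans; rewrite exprMn mulrC ler_wpM2l ?sqr_ge0//; nra.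
Unshelve. all: by end_near. Qed.

Lemma has_sup_diameter S : compact S -> S !=set0 ->
  has_sup [set enorm (x - y) | x in S & y in S].
Proof.
move=> cS [x Sx]; split; first by exists (enorm (x - x)); exists x => //; exists x.
have [M [_ MS]] := compact_bounded cS.
have {}MS y : S y -> `|y| <= M + 1.
  by move=> Sy; apply: (MS (M + 1)) => //; rewrite ltrDl.
exists (Num.sqrt (d%:R * (2 * (M + 1)) ^+ 2)) => _ [y Sy [z Sz <-]].
apply: ler_wsqrtr; apply: le_trans (dotv_le_norm _) _.
rewrite ler_wpM2l// ler_sqr ?nnegrE//.
  by apply: le_trans (ler_normB _ _) _; rewrite mulr_natl mulr2n lerD// MS.
by rewrite mulr_ge0// (le_trans _ (MS x Sx)).
Qed.

Lemma enorm_le_diameter S (x y : 'rV[R]_d) : compact S -> S x -> S y ->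
  enorm (x - y) <= diameter S.
Proof.
move=> cS Sx Sy; apply: sup_upper_bound; last by exists x => //; exists y.
by apply: has_sup_diameter => //; exists x.
Qed.

End EuclideanGeometry.

(** * Partial derivatives *)

Section PartialDerivatives.
Variables (R : realType) (d : nat).
Implicit Types (g : 'rV[R]_d -> R) (i j l : 'I_d) (p x : 'rV[R]_d).

Lemma is_derive_line g i p (s : R) : derivable g (p + s *: unitv R i) (unitv R i) ->
  is_derive s 1 (fun r : R => g (p + r *: unitv R i)) (pd i g (p + s *: unitv R i)).
Proof.
set v := unitv R i => dg.
have E : (fun h => h^-1 *: (((fun r : R => g (p + r *: v)) \o shift s) (h *: 1) -
            g (p + s *: v))) =
         (fun h => h^-1 *: ((g \o shift (p + s *: v)) (h *: v) - g (p + s *: v))).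
  apply/funext => h /=; congr (_ *: (g _ - _)).
  by rewrite [h *: 1]mulr1 scalerDl addrCA.
by apply: DeriveDef; rewrite /derivable /pd /derive E.
Qed.

Lemma pd_mvt g i p (a b : R) : (forall x, derivable g x (unitv R i)) -> a <= b ->
  exists2 c, a <= c <= b &
    g (p + b *: unitv R i) - g (p + a *: unitv R i) =
    pd i g (p + c *: unitv R i) * (b - a).
Proof.
move=> dg ab.
have H s := is_derive_line (dg (p + s *: unitv R i)).
have cont : {within `[a, b], continuous (fun r => g (p + r *: unitv R i))}.
  apply: continuous_subspaceT => s; apply/differentiable_continuous.
  by apply/derivable1_diffP; have [] := H s.
have [c] := MVT_segment ab (fun s _ => H s) cont.
by rewrite in_itv/= => cab E; exists c.
Qed.

(** The mean value theorem is applied along $e_i$ to $x\mapsto g(x+se_j)-g(x)$, then along $e_j$ to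
    $\partial_i g$. *)
Lemma mixed_difference g i j p (s : R) : 0 <= s ->
  (forall x, derivable g x (unitv R i)) ->
  (forall x, derivable (pd i g) x (unitv R j)) ->
  exists a b : R, [/\ 0 <= a <= s, 0 <= b <= s &
    g (p + s *: unitv R i + s *: unitv R j) - g (p + s *: unitv R i)
      - g (p + s *: unitv R j) + g p =
    pd j (pd i g) (p + a *: unitv R i + b *: unitv R j) * s ^+ 2].
Proof.
move=> s0 di dji.
set v := unitv R j; set u := unitv R i.
pose f x := g (x + s *: v) - g x.
have dfx x : is_derive x u f (pd i g (x + s *: v) - pd i g x).
  rewrite /f; have -> : (fun y => g (y + s *: v) - g y) =
    (fun y => g (y + s *: v)) - g by [].
  apply: is_deriveB; last exact: DeriveDef.
  have E : (fun h => h^-1 *: (((fun y => g (y + s *: v)) \o shift x) (h *: u) -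
            g (x + s *: v))) =
         (fun h => h^-1 *: ((g \o shift (x + s *: v)) (h *: u) - g (x + s *: v))).
    by apply/funext => h /=; rewrite addrA.
  by apply: DeriveDef; rewrite /derivable /pd /derive E//; exact: di.
have [|a aS Ea] := @pd_mvt f i p 0 s _ s0.
  by move=> x; have [] := dfx x.
have [b bS Eb] := @pd_mvt (pd i g) j (p + a *: u) 0 s dji s0.
exists a, b; split => //.
have Ef x : pd i f x = pd i g (x + s *: v) - pd i g x.
  by have [_] := dfx x.
rewrite Ef !scale0r !addr0 subr0 -/u -/v in Ea Eb.
have -> : g (p + s *: u + s *: v) - g (p + s *: u) - g (p + s *: v) + g p =
  g (p + s *: u + s *: v) - g (p + s *: u) - (g (p + s *: v) - g p).
  by rewrite opprB addrA addrAC.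
by rewrite [LHS]Ea Eb expr2 mulrA.
Qed.

Lemma norm_unitv i : `|unitv R i| <= 1.
Proof.
rewrite [`|_|]mx_normrE; apply: bigmax_le => [|[a b] _ /=]; first exact: ler01.
by rewrite /unitv mxE; case: (_ && _); rewrite ?normr1 ?normr0.
Qed.

Lemma dist_le_half_sum (e a q b : R) :
  `|a - q| < e / 2 -> `|b - q| < e / 2 -> `|b - a| <= e.
Proof.
by rewrite (distrC a) => h1 h2; apply: le_trans (ler_distD q b a) _; lra.
Qed.

(** Schwarz's theorem. The second difference over a square is symmetric in the two directions, so
    the two mixed derivatives agree at two points arbitrarily close to $p$; continuity does the
    rest. *)
Lemma pd_comm g i j :
  (forall x, derivable g x (unitv R i)) -> (forall x, derivable g x (unitv R j)) ->
  (forall x, derivable (pd i g) x (unitv R j)) ->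
  (forall x, derivable (pd j g) x (unitv R i)) ->
  continuous (pd j (pd i g)) -> continuous (pd i (pd j g)) ->
  pd i (pd j g) = pd j (pd i g).
Proof.
move=> di dj dji dij cji cij; apply/funext => p.
apply/eqP; rewrite -subr_eq0 -normr_le0; apply/ler_addgt0Pl => e e0; rewrite addr0.
have e2 : 0 < e / 2 by rewrite divr_gt0.
have /(@cvgrPdist_lt _ _ _ (nbhs p))/(_ _ e2)/nbhs_ballP[r1 /= r10 B1] := cji p.
have /(@cvgrPdist_lt _ _ _ (nbhs p))/(_ _ e2)/nbhs_ballP[r2 /= r20 B2] := cij p.
(* Each mixed derivative is evaluated at $p$ plus two displacements of length at most $s$, and $2s$
   stays below both radii. *)
pose s := Num.min r1 r2 / 3.
have m0 : 0 < Num.min r1 r2 by rewrite lt_min r10.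
have s0 : 0 < s by rewrite divr_gt0.
have near a b (u v : 'I_d) : 0 <= a <= s -> 0 <= b <= s ->
    `|p - (p + a *: unitv R u + b *: unitv R v)| < Num.min r1 r2.
  move=> /andP[a0 as_] /andP[b0 bs].
  rewrite -addrA opprD addrA subrr add0r normrN.
  apply: le_lt_trans (ler_normD _ _) _; rewrite !normrZ !ger0_norm//.
  have := norm_unitv u; have := norm_unitv v.
  have := normr_ge0 (unitv R u); have := normr_ge0 (unitv R v).
  move: `|unitv R u| `|unitv R v| => x y x0 y0 x1 y1.
  have h1 : a * x <= s by nra.
  have h2 : b * y <= s by nra.
  by move: h1 h2; rewrite /s; lra.
have [a [b [aS bS E1]]] := mixed_difference p (ltW s0) di dji.
have [a' [b' [aS' bS' E2]]] := mixed_difference p (ltW s0) dj dij.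
have E : pd j (pd i g) (p + a *: unitv R i + b *: unitv R j) =
         pd i (pd j g) (p + a' *: unitv R j + b' *: unitv R i).
  apply: (@mulIf _ (s ^+ 2)); first by rewrite expf_neq0// gt_eqF.
  apply: (etrans (esym E1)); apply: (etrans _ E2).
  rewrite (addrAC p (s *: unitv R j)).
  move: (g (p + s *: unitv R i + s *: unitv R j)) (g (p + s *: unitv R i)).
  by move: (g (p + s *: unitv R j)) (g p) => A B C D; ring.
have H1 := B1 (p + a *: unitv R i + b *: unitv R j).
have H2 := B2 (p + a' *: unitv R j + b' *: unitv R i).
have {}H1 : `|pd j (pd i g) p - pd j (pd i g) (p + a *: unitv R i + b *: unitv R j)| < e / 2.
  apply: H1; rewrite -ball_normE/=.
  by apply: lt_le_trans (near _ _ _ _ aS bS) _; rewrite ge_min lexx.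
have {}H2 : `|pd i (pd j g) p - pd i (pd j g) (p + a' *: unitv R j + b' *: unitv R i)| < e / 2.
  apply: H2; rewrite -ball_normE/=.
  by apply: lt_le_trans (near _ _ _ _ aS' bS') _; rewrite ge_min lexx orbT.
rewrite E in H1.
set q := pd i (pd j g) (_ + _ + _) in H1 H2.
exact (dist_le_half_sum H1 H2).
Qed.

Lemma pdnS k j g : pdn k.+1 j g = pd j (pdn k j g).
Proof. by []. Qed.

Lemma pdn_pd_seq k j g : pdn k j g = pd_seq (nseq k j) g.
Proof. by elim: k => //= k ->. Qed.

Lemma Cn_pdn_derivable n g k j : Cn n g -> (k < n)%N ->
  forall i x, derivable (pdn k j g) x (unitv R i).
Proof.
move=> gn kn; rewrite pdn_pd_seq.
by have [|_] := gn (nseq k j); rewrite size_nseq ?(ltnW kn)//; apply.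
Qed.

Lemma Cn_pd_pdn_derivable n g k j i : Cn n g -> (k.+1 < n)%N ->
  forall l x, derivable (pd i (pdn k j g)) x (unitv R l).
Proof.
move=> gn kn; rewrite pdn_pd_seq.
by have [|_] := gn (i :: nseq k j); rewrite /= size_nseq ?(ltnW kn)//; apply.
Qed.

Lemma Cn_pdn_continuous n g k j : Cn n g -> (k <= n)%N -> continuous (pdn k j g).
Proof.
by move=> gn kn; rewrite pdn_pd_seq; have [|] := gn (nseq k j); rewrite ?size_nseq.
Qed.

Lemma Cn_pd_pd_pdn_continuous n g k j i l : Cn n g -> (k.+2 <= n)%N ->
  continuous (pd l (pd i (pdn k j g))).
Proof.
move=> gn kn; rewrite pdn_pd_seq.
by have [|] := gn [:: l, i & nseq k j]; rewrite /= ?size_nseq.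
Qed.

(** One $\partial_l$ is carried through the $\partial_j$ one at a time, each exchange using
    continuous second derivatives of a lower [pdn]. *)
Lemma pdn_pdC n g k j l : Cn n g -> (k < n)%N ->
  pdn k j (pd l g) = pd l (pdn k j g).
Proof.
move=> gn; elim: k => // k IH kn.
rewrite (pdnS k j (pd l g)) (pdnS k j g) (IH (ltnW kn)).
apply: pd_comm.
- exact: Cn_pdn_derivable gn (ltnW kn) _.
- exact: Cn_pdn_derivable gn (ltnW kn) _.
- exact: Cn_pd_pdn_derivable gn kn _.
- exact: Cn_pd_pdn_derivable gn kn _.
- exact: Cn_pd_pd_pdn_continuous gn kn.
- exact: Cn_pd_pd_pdn_continuous gn kn.
Qed.

End PartialDerivatives.

Section MultiIndex.
Variables (R : realType) (d : nat).
Implicit Types (g : 'rV[R]_d -> R) (i j l : 'I_d).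

(** [Dmulti] differentiates in the order of [enum 'I_d], so $\partial_l$ may end up inside
    $\partial_j^k$; it is brought outside here. *)
Lemma Dmulti_axis n n' g k j l (m : {ffun 'I_d -> 'I_n'.+1}) :
  Cn n g -> (k < n)%N -> (forall i, (m i : nat) = ((i == j) * k + (i == l))%N) ->
  Dmulti m g = pd l (pdn k j g).
Proof.
move=> gn kn Em.
(* In the induction on [s], membership of [l] and [j] tells which derivatives are already present;
   only [j] met after [l] requires an exchange. *)
suff H s : uniq s -> foldr (fun i h => pdn (m i) i h) g s =
    (if l \in s then pd l else id) (pdn (if j \in s then k else 0) j g).
  by rewrite /Dmulti H ?enum_uniq// !mem_enum.
elim: s => [//|i s IH] /= /andP[is_ us]; rewrite {}IH// !inE Em.
rewrite (eq_sym j) (eq_sym l).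
have [Eij|nij] := eqVneq i j; have [Eil|nil_] := eqVneq i l.
- by rewrite -Eij -Eil (negbTE is_) /= mul1n addn1.
- rewrite -Eij (negbTE is_) /= mul1n addn0.
  by case: (l \in s) => //; exact: pdn_pdC gn kn.
- by rewrite -Eil (negbTE is_).
- by [].
Qed.

End MultiIndex.

(** * Query points and the landscape around the minimizer *)

Section Landscape.
Variables (R : realType) (d : nat).
Implicit Types (f g : 'rV[R]_d -> R) (i j l : 'I_d) (p x : 'rV[R]_d).
Implicit Types (S : set 'rV[R]_d).

(** The form $(|a|+|b|)^2$ also covers $j=l$, where the two displacements add up. *)
Lemma dotv_unitv (a b : R) j l :
  dotv (a *: unitv R j + b *: unitv R l) (a *: unitv R j + b *: unitv R l) <=
  (`|a| + `|b|) ^+ 2.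
Proof.
have E i i' : dotv (unitv R i) (unitv R i') = (i == i')%:R.
  rewrite /dotv (bigD1 i)//= big1 ?addr0 => [|q qi]; rewrite /unitv !mxE !eqxx/= ?mul1r//.
  by rewrite (negbTE qi) mul0r.
rewrite !(dotvDl, dotvDr, dotvZl, dotvZr) !E !eqxx !mulr1 (eq_sym l j).
rewrite sqrrD -!normrX ![`|_ ^+ 2|]ger0_norm ?sqr_ge0//.
have : a * b <= `|a| * `|b| by rewrite -normrM ler_norm.
have : 0 <= `|a| * `|b| by rewrite mulr_ge0.
by move: (`|a| * `|b|) => ab; case: (j == l) => /=; rewrite ?mulr1 ?mulr0 => h1 h2; nra.
Qed.

(** The distance to the set is at most the displacement from [x]; this keeps the queries where
    $\nabla g$ is controlled. *)
Lemma fattening_query S x (a b : R) j l : S x -> `|a| + `|b| <= 1 ->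
  fattening S (x + a *: unitv R j + b *: unitv R l).
Proof.
move=> Sx ab; rewrite /fattening/= /dist.
apply: le_trans (_ : enorm (x + a *: unitv R j + b *: unitv R l - x) <= 1).
  apply: ge_inf; last by exists x.
  by exists 0 => _ [y Sy <-]; exact: enorm_ge0.
rewrite -[x + _ + _]addrA [x + (_ + _)]addrC addrK -ler_sqr ?nnegrE ?enorm_ge0//.
rewrite enorm_sqr expr1n; apply: le_trans (dotv_unitv _ _ _ _) _.
by rewrite -[leRHS](@expr1n _ 2) ler_sqr ?nnegrE// addr_ge0.
Qed.

Lemma pd_le_grad g i x : `|pd i g x| <= enorm (grad g x).
Proof. by have := coord_le_enorm (grad g x) i; rewrite mxE. Qed.

(** Mean value theorem on the segment between the two queries: its length is $2h|v|\le h$, and it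
    lies in the fattening since $|hu|+|hv|\le1$. *)
Lemma query_difference_le S g j l x (h u v Gg : R) :
  (forall x, derivable g x (unitv R l)) ->
  (forall x, fattening S x -> enorm (grad g x) <= Gg) ->
  S x -> 0 <= h <= 1 -> `|u| <= 1 / 2 -> `|v| <= 1 / 2 ->
  `|g (x + (h * u) *: unitv R j + (h * v) *: unitv R l) -
    g (x + (h * u) *: unitv R j - (h * v) *: unitv R l)| <= h * Gg.
Proof.
move=> dg Gb Sx /andP[h0 h1] u1 v1.
wlog v0 : v v1 / 0 <= v.
  move=> H; have [/H|/ltW v0] := leP 0 v; first exact.
  have := H (- v); rewrite normrN oppr_ge0 mulrN !scaleNr opprK distrC.
  exact.
rewrite -scaleNr.
have hv : - (h * v) <= h * v by have := mulr_ge0 h0 v0; lra.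
have [c /andP[c1 c2] ->] := pd_mvt (x + (h * u) *: unitv R j) dg hv.
have hu : `|h * u| <= 1 / 2.
  by rewrite normrM ger0_norm//; have := normr_ge0 u; nra.
rewrite ger0_norm// in v1.
have c3 : `|c| <= 1 / 2 by rewrite ler_norml; apply/andP; split; nra.
have /(Gb _) : fattening S (x + (h * u) *: unitv R j + c *: unitv R l).
  by apply: fattening_query => //; lra.
move=> /(le_trans (pd_le_grad g l _)); rewrite normrM.
move: `|pd l g _| (normr_ge0 (pd l g (x + (h * u) *: unitv R j + c *: unitv R l))) => D D0 DG.
rewrite ger0_norm ?subr_ge0// opprK -mulr2n -mulr_natl mulrC.
apply: ler_pM => //; first by rewrite mulr_ge0// mulr_ge0.
nra.
Qed.

Section Minimizer.
Variables (S : set 'rV[R]_d) (f : 'rV[R]_d -> R) (alpha Lf : R) (xs : 'rV[R]_d).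
Hypotheses (alpha0 : 0 < alpha) (Lf0 : 0 < Lf).
Hypotheses (sc : strongly_convex alpha f S) (lip : lipschitz_with Lf (grad f) S).
Hypotheses (ixs : interior S xs) (fmin : forall y, S y -> f xs <= f y).

Let Sxs : S xs. Proof. exact: nbhs_singleton ixs. Qed.

(* A short step from [xs] along [- F], where [F := grad f xs], stays in [S];
   there the gradient has a nonpositive product with [F] by convexity, yet is
   close to [F] by the Lipschitz condition. Differentiability is not involved. *)
Lemma grad_minimizer : grad f xs = 0.
Proof.
apply: dotv_eq0; set F := grad f xs; set N := dotv F F.
have N0 : 0 <= N by exact: dotv_ge0.
have [r /= r0 Br] : exists2 r : R, 0 < r & forall y, `|xs - y| < r -> S y.
  have /nbhs_ballP[r r0 Br] := ixs; exists r => // y xy; apply: Br.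
  by rewrite -ball_normE.
have F0 := normr_ge0 F.
(* The first bound keeps the step inside the ball of radius [r]; the second limits the change of
   gradient to half the length of [F]. *)
pose s := Num.min (r / (`|F| + 1)) (1 / 2 / Lf).
have s0 : 0 < s by rewrite lt_min !divr_gt0// ltr_wpDl.
have sL : s * Lf <= 1 / 2 by rewrite -ler_pdivlMr// ge_min lexx orbT.
have Sy : S (xs - s *: F).
  apply: Br; rewrite subKr normrZ gtr0_norm//.
  have : s * (`|F| + 1) <= r by rewrite -ler_pdivlMr ?ltr_wpDl// ge_min lexx.
  by apply: lt_le_trans; rewrite ltr_pM2l// ltrDl.
have := sc Sy Sxs; have := fmin Sy.
rewrite subKr dotvZr => h1 h2.
have h3 : dotv (grad f (xs - s *: F)) F <= 0.
  rewrite -(pmulr_rle0 _ s0).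
  have : 0 <= alpha / 2 * enorm (s *: F) ^+ 2.
    by rewrite mulr_ge0 ?sqr_ge0// divr_ge0// ltW.
  lra.
have h4 : dotv (F - grad f (xs - s *: F)) (F - grad f (xs - s *: F)) <= N / 4.
  rewrite -enorm_sqr.
  have /= := lip Sxs Sy; rewrite -/F subKr => h.
  have : enorm (F - grad f (xs - s *: F)) ^+ 2 <= (Lf * enorm (s *: F)) ^+ 2.
    by rewrite ler_sqr ?nnegrE ?mulr_ge0 ?enorm_ge0// ltW.
  move/le_trans; apply; rewrite exprMn enorm_sqr dotvZl dotvZr -/N.
  have : (s * Lf) ^+ 2 <= (1 / 2) ^+ 2 by rewrite ler_sqr// nnegrE ?divr_ge0// mulr_ge0 ?ltW.
  rewrite exprMn => h'.
  have -> : Lf ^+ 2 * (s * (s * N)) = s ^+ 2 * Lf ^+ 2 * N by ring.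
  have -> : N / 4 = (1 / 2) ^+ 2 * N by field.
  by rewrite ler_wpM2r.
(* With $y$ the gradient after the step, $\|(F-y)-F\|^2\ge0$ gives $\|F\|^2\le\|F-y\|^2+2\langle
   y,F\rangle\le\|F\|^2/4$. *)
have := dotv_ge0 ((F - grad f (xs - s *: F)) - F); rewrite dotvBB -/N.
move: h4; move: (dotv (F - _) (F - _)) => A h4.
rewrite dotvDl dotvNl -/N => h5; apply/eqP; rewrite eq_le N0 andbT.
by move: h3 h4 h5; move: (dotv _ F) => B; lra.
Qed.

(** Strong convexity from [xs] to [x] and from [x] to [xs], added with $\nabla f(x^\star)=0$; each
    contributes $\alpha/2$. *)
Lemma grad_monotone x : S x ->
  alpha * dotv (x - xs) (x - xs) <= dotv (grad f x) (x - xs).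
Proof.
move=> Sx; have := sc Sxs Sx; have := sc Sx Sxs.
rewrite grad_minimizer /enorm !sqr_sqrtr ?dotv_ge0// (dotv_distC xs x).
rewrite -(opprB x xs) dotvNr -[0](scale0r 0) dotvZl mul0r.
by move: (dotv (grad f x) _) (dotv (x - xs) _) => A B; lra.
Qed.

(** Convexity bounds the gap by $\langle\nabla f(x),x-x^\star\rangle$. Expanding $\|\nabla
    f(x)-L_f(x-x^\star)\|^2\ge0$ then plays the role of Cauchy-Schwarz. *)
Lemma suboptimality_le x : S x -> f x - f xs <= Lf * dotv (x - xs) (x - xs).
Proof.
move=> Sx; have := sc Sx Sxs; rewrite -(opprB x xs) dotvNr.
have : 0 <= alpha / 2 * enorm (- (x - xs)) ^+ 2.
  by rewrite mulr_ge0 ?sqr_ge0// divr_ge0// ltW.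
have := lip Sx Sxs; rewrite grad_minimizer subr0 => h.
have {}h : enorm (grad f x) ^+ 2 <= (Lf * enorm (x - xs)) ^+ 2.
  by rewrite ler_sqr ?nnegrE ?mulr_ge0 ?enorm_ge0// ltW.
rewrite exprMn !enorm_sqr in h.
have := dotv_ge0 (grad f x - Lf *: (x - xs)).
rewrite (dotvBB (grad f x)) !(dotvZl, dotvZr).
move: h; move: (dotv (grad f x) (grad f x)) (dotv (grad f x) (x - xs)) (dotv (x - xs) (x - xs)).
move=> A B C h1 h2 h3 h4.
have h5 : 2 * Lf * B <= 2 * Lf * (Lf * C) by rewrite expr2 in h1; lra.
have : B <= Lf * C by move: h5; rewrite ler_pM2l// mulr_gt0.
move: h3 h4; move: (_ * enorm _ ^+ 2) => E; lra.
Qed.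

End Minimizer.
End Landscape.

(** * Freezing independent variables *)

Section MeasurableVectors.
Variables (R : realType) (d : nat) (dT : measure_display) (T : measurableType dT).

(** Measurability of a random vector is expressed through its coordinates; this passes from there to
    continuous functions of the vector. *)
Lemma measurable_comp_rV (g : 'rV[R]_d -> R) (X : T -> 'rV[R]_d) :
  continuous g -> (forall i, measurable_fun setT (fun w => X w 0 i)) ->
  measurable_fun setT (fun w => g (X w)).
Proof.
move=> cg mX.
(* An open set of vectors is a countable union of sup-norm balls with rational
   centers. *)
apply: (measurability _ (RGenOpens.measurableE R)).
move=> _ [_ [a [b ->]] <-]; rewrite setTI.
set U := g @^-1` `]a, b[%classic.
have oU : open U.
  by apply: open_comp => [x _|]; [exact: cg|exact: interval_open].
pose box (p : 'rV[rat]_d * nat) : set 'rV[R]_d :=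
  ball (map_mx ratr p.1 : 'rV[R]_d) p.2.+1%:R^-1.
have -> : (fun w => g (X w)) @^-1` `]a, b[%classic =
    \bigcup_p (if `[< box p `<=` U >] then X @^-1` box p else set0).
  apply/seteqP; split=> [w Uw|w [p _]]; last first.
    by case: ifPn => // /asboolP pU /pU.
  have /(@open_nbhs_nbhs _ (X w))/nbhs_ballP[r /= r0 Br] : open_nbhs (X w) U by [].
  (* A box of radius $1/(n+1)$ that contains [X w] lies within $2/(n+1)<r$ of it. *)
  pose n := Num.trunc (2 / r).
  have n0 : 0 < n.+1%:R :> R by [].
  have nr : 2 * n.+1%:R^-1 < r.
    by rewrite ltr_pdivrMr// -ltr_pdivrMl// mulrC; exact: truncnS_gt.
  have q_ex (i : 'I_d) : exists q : rat, `|ratr q - X w 0 i| < n.+1%:R^-1.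
    have [|q] := @rat_in_itvoo R (X w 0 i - n.+1%:R^-1) (X w 0 i + n.+1%:R^-1).
      by rewrite ltrBlDr -addrA ltrDl addr_gt0 ?invr_gt0.
    rewrite in_itv/= => /andP[q1 q2]; exists q.
    by rewrite ltr_distl q1.
  have [q Hq] := choice q_ex.
  exists (\row_i q i, n) => //=.
  have wb : box (\row_i q i, n) (X w).
    rewrite /box/= -ball_normE/= [X in X < _]mx_normrE.
    apply: bigmax_lt; first by rewrite invr_gt0.
    by move=> [i j] _ /=; rewrite !mxE (ord1 i).
  rewrite ifT//; apply/asboolP => y yb; apply: Br.
  apply: le_ball (ltW nr) _ _; rewrite mulr2n mulrDl mul1r.
  by apply: ball_triangle yb; exact: ball_sym.
apply: countable_bigcupT_measurable => [|p]; first exact: countableP.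
case: ifP => // _; rewrite /box.
have -> : X @^-1` ball (map_mx ratr p.1 : 'rV[R]_d) p.2.+1%:R^-1 =
   \bigcap_(i in [set: 'I_d]) ((fun w => X w 0 i) @^-1` ball (ratr (p.1 0 i) : R) p.2.+1%:R^-1).
  apply/seteqP; split => w /=.
    by case=> _ H i _ /=; have := H 0 i; rewrite mxE.
  move=> H; split => // i j; rewrite (ord1 i) mxE; exact: (H j I).
apply: fin_bigcap_measurable => [|i _]; first exact: finite_finset.
rewrite -[X in measurable X]setTI.
by apply: mX => //; apply: open_measurable; exact: ball_open.
Qed.

End MeasurableVectors.

Section Freezing.
Context {R : realType} {d1 dO : measure_display}.
Context {T1 : measurableType d1} {Omega : measurableType dO}.
Variables (P : probability Omega R) (mu : probability T1 R).
Variables (G : set (set Omega)) (X : Omega -> T1).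
Hypothesis (GM : G `<=` measurable) (mX : measurable_fun setT X).
Hypothesis indep : forall A C, measurable A -> <<s G >> C ->
  (P (X @^-1` A `&` C) = mu A * P C)%E.

Let Omega' : measurableType _ := g_sigma_algebraType G.
Let inj : Omega -> Omega' := id.
Let minj : measurable_fun setT inj.
Proof.
move=> _ A mA; rewrite setTI; apply: (smallest_sub _ GM) mA.
exact: sigma_algebra_measurable.
Qed.
Let joint (w : Omega) : Omega' * T1 := (inj w, X w).
Let mjoint : measurable_fun setT joint.
Proof. exact/measurable_fun_pairP. Qed.

HB.instance Definition _ := isMeasurableFun.Build _ _ _ _ inj minj.
HB.instance Definition _ := isMeasurableFun.Build _ _ _ _ joint mjoint.

Let P' : probability Omega' R := distribution P inj.

Let joint_law A : measurable A -> (P' \x mu)%E A = distribution P joint A.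
Proof.
apply: product_measure_unique => B C mB mC.
transitivity (P (X @^-1` C `&` B)); last by rewrite indep// muleC.
by congr (P _); apply/seteqP; split => w [].
Qed.

(* By independence the law of [(id, X)] on [Omega] equipped with the coarser
   sigma-algebra generated by [G] is a product measure, so Fubini applies. *)
Lemma le_freezing (H : Omega' * T1 -> R) (q : Omega -> R) :
  measurable_fun setT H ->
  P.-integrable setT (EFin \o (fun w => H (w, X w))) ->
  (forall w, mu.-integrable setT (EFin \o (fun x => H (w, x)))) ->
  P.-integrable setT (EFin \o q) ->
  (forall w, \int[mu]_x H (w, x) <= q w) ->
  \int[P]_w H (w, X w) <= \int[P]_w q w.
Proof.
move=> mH iH iHw iq Hq.
move/measurable_EFinP : (mH) => mEH.
have iH' : (P' \x mu)%E.-integrable setT (EFin \o H).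
  apply/integrableP; split=> //.
  rewrite (eq_measure_integral (distribution P joint))//; last first.
    by move=> A mA _; exact: joint_law.
  rewrite ge0_integral_distribution//; last exact: measurableT_comp.
  by move/integrableP : iH => [].
have E : (\int[P]_w (H (w, X w))%:E = \int[P']_w \int[mu]_x (H (w, x))%:E)%E.
  rewrite -(integral_distribution (X := joint) (f := EFin \o H))//.
  rewrite (eq_measure_integral (P' \x mu)%E); last first.
    by move=> A mA _; apply: esym; exact: joint_law.
  by rewrite -integral12_prod_meas1.
have iI : P'.-integrable setT (fubini_F mu (EFin \o H)) by exact: integrable_fubini_F.
have mI : measurable_fun setT (fubini_F mu (EFin \o H)) by exact: measurable_int iI.
have iI' : P.-integrable setT (fubini_F mu (EFin \o H) \o inj).
  apply/integrableP; split; first exact: measurableT_comp.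
  move/integrableP : iI => [_].
  by rewrite ge0_integral_distribution//; exact: measurableT_comp.
apply: fine_le.
- exact: integrable_fin_num.
- exact: integrable_fin_num.
rewrite E (integral_distribution mI iI').
apply: le_integral => // w _ /=; rewrite /fubini_F/=.
rewrite -[leLHS]fineK; last exact: integrable_fin_num (iHw w).
by rewrite lee_fin; exact: Hq.
Qed.

End Freezing.

(** * The algebra of bounded measurable functions *)

Section BoundedMeasurable.
Context {R : realType} {dT : measure_display} {T : measurableType dT}.
Implicit Types F H : T -> R.

(** Such functions are integrable for every probability and form an algebra, so integrability
    obligations reduce to the shape of the integrand. *)
Definition bddm F := measurable_fun setT F /\ exists M : R, forall z, `|F z| <= M.

Lemma bddm_cst (c : R) : bddm (fun=> c).
Proof. by split; [exact: measurable_cst|exists `|c|]. Qed.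

Lemma bddmM F H : bddm F -> bddm H -> bddm (fun z => F z * H z).
Proof.
move=> [mF [M FM]] [mH [N HN]]; split; first exact: measurable_funM.
by exists (M * N) => z; rewrite normrM ler_pM.
Qed.

Lemma bddmD F H : bddm F -> bddm H -> bddm (fun z => F z + H z).
Proof.
move=> [mF [M FM]] [mH [N HN]]; split; first exact: measurable_funD.
by exists (M + N) => z; rewrite (le_trans (ler_normD _ _))// lerD.
Qed.

Lemma bddmX F n : bddm F -> bddm (fun z => F z ^+ n).
Proof.
move=> bF; elim: n => [|n IH]; first exact: bddm_cst.
by under eq_fun do rewrite exprS; exact: bddmM.
Qed.

Lemma bddm_norm F : bddm F -> bddm (fun z => `|F z|).
Proof.
move=> [mF [M FM]]; split; first exact: measurableT_comp.
by exists M => z; rewrite normr_id.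
Qed.

Lemma bddm_sum I (s : seq I) (p : pred I) (F : I -> T -> R) :
  (forall i, p i -> bddm (F i)) -> bddm (fun z => \sum_(i <- s | p i) F i z).
Proof.
move=> bF; elim: s => [|i s IH].
  by under eq_fun do rewrite big_nil; exact: bddm_cst.
under eq_fun do rewrite big_cons.
by have := bF i; case: (p i) => // /(_ isT) bFi; exact: bddmD.
Qed.

Variable mu : probability T R.

Lemma bddm_integrable F : bddm F -> mu.-integrable setT (EFin \o F).
Proof.
move=> [mF [M FM]]; apply: measurable_bounded_integrable => //.
  exact: (le_lt_trans (probability_le1 mu measurableT) (ltry _)).
by exists M; split; [exact: num_real|move=> N MN z _ /=; exact: le_trans (FM z) (ltW MN)].
Qed.

Lemma integrableDr F H : mu.-integrable setT (EFin \o F) ->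
  mu.-integrable setT (EFin \o H) -> mu.-integrable setT (EFin \o (fun z => F z + H z)).
Proof. by move=> iF iH; exact: (integrableD measurableT iF iH). Qed.

Lemma integrableZr (a : R) F : mu.-integrable setT (EFin \o F) ->
  mu.-integrable setT (EFin \o (fun z => a * F z)).
Proof.
move=> iF; have := integrableZl measurableT a iF.
by congr (_.-integrable _ _); apply/funext => z; rewrite /= EFinM.
Qed.

Lemma integrable_sumr I (s : seq I) (p : pred I) (F : I -> T -> R) :
  (forall i, p i -> mu.-integrable setT (EFin \o F i)) ->
  mu.-integrable setT (EFin \o (fun z => \sum_(i <- s | p i) F i z)).
Proof.
move=> iF; have -> : EFin \o (fun z => \sum_(i <- s | p i) F i z) =
    (fun z => \sum_(i <- s | p i) (EFin \o F i) z)%E.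
  by apply/funext => z; rewrite /= sumEFin.
exact: integrable_sum.
Qed.

Lemma Rintegral_sum I (s : seq I) (p : pred I) (F : I -> T -> R) :
  (forall i, p i -> mu.-integrable setT (EFin \o F i)) ->
  \int[mu]_z (\sum_(i <- s | p i) F i z) = \sum_(i <- s | p i) \int[mu]_z F i z.
Proof.
move=> iF; elim: s => [|i s IH].
  rewrite big_nil; under eq_Rintegral do rewrite big_nil.
  by rewrite Rintegral_cst// mul0r.
rewrite big_cons; under eq_Rintegral do rewrite big_cons.
have := iF i; case: (p i) => // /(_ isT) iFi.
by rewrite -IH RintegralD//; exact: integrable_sumr.
Qed.

Lemma Rintegral_bddm_sum I (s : seq I) (p : pred I) (F : I -> T -> R) :
  (forall i, p i -> bddm (F i)) ->
  \int[mu]_z (\sum_(i <- s | p i) F i z) = \sum_(i <- s | p i) \int[mu]_z F i z.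
Proof. by move=> bF; apply: Rintegral_sum => i pi; apply: bddm_integrable; exact: bF. Qed.

(* The variance of [|F|] is nonnegative. *)
Lemma Rintegral_norm_le_sqrt F : bddm F ->
  \int[mu]_z `|F z| <= Num.sqrt (\int[mu]_z (F z ^+ 2)).
Proof.
move=> bF; set m := \int[mu]_z `|F z|.
have bN := bddm_norm bF.
have m0 : 0 <= m by apply: Rintegral_ge0.
rewrite -ler_sqr ?nnegrE ?sqrtr_ge0// sqr_sqrtr; last first.
  by apply: Rintegral_ge0 => z _; rewrite sqr_ge0.
have : 0 <= \int[mu]_z ((`|F z| - m) ^+ 2) by apply: Rintegral_ge0 => z _; rewrite sqr_ge0.
have E z : (`|F z| - m) ^+ 2 = F z ^+ 2 + ((- (2 * m)) * `|F z| + m ^+ 2).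
  by rewrite -[F z ^+ 2]real_normK ?num_real//; ring.
under eq_Rintegral do rewrite E.
have b1 : bddm (fun z => - (2 * m) * `|F z|) by exact: bddmM (bddm_cst _) bN.
rewrite RintegralD//; [|exact: bddm_integrable (bddmX 2 bF)
  |exact: bddm_integrable (bddmD b1 (bddm_cst _))].
rewrite RintegralD//; [|exact: bddm_integrable b1|exact: bddm_integrable (bddm_cst _)].
rewrite RintegralZl//; last exact: bddm_integrable bN.
rewrite Rintegral_cst// -/m; have -> : fine (mu setT) = 1 by rewrite probability_setT.
by move: (\int[mu]_z (F z ^+ 2)) => A; nra.
Qed.

End BoundedMeasurable.

Lemma bddm_comp (R : realType) d1 d2 (T1 : measurableType d1) (T2 : measurableType d2)
    (f : T1 -> T2) (F : T2 -> R) :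
  measurable_fun setT f -> bddm F -> bddm (F \o f).
Proof.
move=> mf [mF [M FM]]; split; first exact: measurableT_comp.
by exists M => z; exact: FM.
Qed.

(** * Bias and variance of the kernel estimator *)

Section KernelMoments.
Variable R : realType.
Let RT := measurableTypeR R.
Implicit Types K : R -> R.

(** The interval has length 1, so the density is 1. The formula for the uniform integral concerns
    nonnegative functions, hence the split into positive and negative parts. *)
Lemma Rintegral_unif (f : RT -> R) : bddm f ->
  \int[unif R]_u f u = \int[lebesgue_measure]_(u in @kitv R) f u.
Proof.
move=> [mf _]; rewrite /Rintegral; congr fine.
have mE : measurable_fun setT (EFin \o f) by exact/measurable_EFinP.
have c1 : (2^-1 - - 2^-1 : R)^-1 = 1 by field.
rewrite [LHS]integralE [RHS]integralE.
rewrite !integral_uniform//; last 2 first.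
- exact: measurable_funeneg.
- exact: measurable_funepos.
by rewrite c1 !mul1e.
Qed.

Lemma kext_out K u : ~ @kitv R u -> kext K u = 0.
Proof. by move=> Ku; rewrite /kext patchE memNset. Qed.

Lemma kitv_norm u : @kitv R u -> `|u| <= 1 / 2.
Proof. by rewrite /kitv/= in_itv/= mul1r -ler_norml. Qed.

Lemma bddm_kext K a : bounded_kernel K -> bddm (fun u : RT => kext K u * u ^+ a).
Proof.
move=> [mK [M KM]]; split.
  apply: measurable_funM; last exact: measurable_funX.
  by apply/(measurable_restrictT _ _).1 => //; exact: measurable_itv.
exists (Num.max M 0) => u; have [Ku|Ku] := pselect (@kitv R u); last first.
  by rewrite kext_out// mul0r normr0 le_max lexx orbT.
rewrite normrM normrX /kext patchE mem_set// -[leRHS]mulr1 ler_pM//.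
  by rewrite le_max KM.
by rewrite exprn_ile1// (le_trans (kitv_norm Ku))//; lra.
Qed.

Lemma bddm_kext0 K : bounded_kernel K -> bddm (fun u : RT => kext K u).
Proof. by move=> bK; have := bddm_kext 0 bK; under eq_fun do rewrite mulr1. Qed.

Lemma Rintegral_kext K a : bounded_kernel K ->
  \int[unif R]_u (kext K u * u ^+ a) = kmoment K a.
Proof.
move=> bK; rewrite Rintegral_unif; last exact: bddm_kext.
apply: eq_Rintegral => u; rewrite inE => Ku.
by rewrite /kext patchE mem_set// mulrC.
Qed.

Lemma ksqE K : ksq K = \int[unif R]_u (kext K u ^+ 2).
Proof. by rewrite /ksq unlock. Qed.

Lemma ksq_ge0 K : 0 <= ksq K.
Proof. by rewrite ksqE; apply: Rintegral_ge0 => u _; rewrite sqr_ge0. Qed.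

Definition unif2 : probability (RT * RT)%type R := (unif R \x unif R)%E.

Lemma Rintegral_unif2 (p q : RT -> R) : bddm p -> bddm q ->
  \int[unif2]_z (p z.1 * q z.2) = \int[unif R]_u p u * \int[unif R]_v q v.
Proof.
move=> bp bq.
have b : bddm (fun z : RT * RT => p z.1 * q z.2).
  by apply: bddmM; [exact: (bddm_comp measurable_fst)|exact: (bddm_comp measurable_snd)].
have ib := bddm_integrable unif2 b.
have ip := bddm_integrable (unif R) bp; have iq := bddm_integrable (unif R) bq.
rewrite /Rintegral -[X in fine X](integral12_prod_meas1 ib) /fubini_F.
have E u : (\int[unif R]_v ((p u * q v)%R)%:E = ((p u * (\int[unif R]_v q v)%R)%R)%:E)%E.
  rewrite EFinM /Rintegral fineK; last exact: integrable_fin_num iq.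
  by rewrite -integralZl.
transitivity (\int[unif R]_u (p u * \int[unif R]_v q v)); last exact: RintegralZr.
by congr fine; apply: eq_integral => u _; rewrite -E.
Qed.

End KernelMoments.

(** * Moments of the kernel weight against monomials *)

Section QueryMoments.
Variables (R : realType) (d : nat) (j l : 'I_d) (k n : nat) (Kk K1 : R -> R) (h : R).
Hypotheses (hk : kernel_k n k Kk) (h1 : kernel_1 n K1).
Let RT := measurableTypeR R.

Definition kweight (z : RT * RT) : R := kext Kk z.1 * kext K1 z.2.

Let bKk : bounded_kernel Kk. Proof. by case: hk. Qed.
Let bK1 : bounded_kernel K1. Proof. by case: h1. Qed.

(** In this identity and the next, [s] is the sign $(-1)^b$ produced by replacing $v$ with $-v$, [p]
    and [q] are powers of $u$ and $v$, and [w] is the weight. *)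
Let even_odd_split (a w p q s : R) c :
  a * (w * (p * q *+ c - p * (s * q) *+ c)) = a * c%:R * (w * (p * q * (1 - s))).
Proof. by rewrite -(mulr_natr (p * q)) -(mulr_natr (p * (s * q))); ring. Qed.

Let odd_split (a w p q s : R) :
  w * (a * (p * q) - a * (p * (s * q))) = a * (w * (p * q * (1 - s))).
Proof. by ring. Qed.

Lemma bddm_kweightX a b : bddm (fun z : RT * RT => kweight z * (z.1 ^+ a * z.2 ^+ b)).
Proof.
have -> : (fun z : RT * RT => kweight z * (z.1 ^+ a * z.2 ^+ b)) =
  (fun z => (kext Kk z.1 * z.1 ^+ a) * (kext K1 z.2 * z.2 ^+ b)).
  by apply/funext => z; rewrite /kweight mulrACA.
apply: bddmM.
  exact: (bddm_comp measurable_fst (bddm_kext a bKk)).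
exact: (bddm_comp measurable_snd (bddm_kext b bK1)).
Qed.

Lemma bddm_kweight : bddm kweight.
Proof.
by have := bddm_kweightX 0 0; under eq_fun do rewrite mulr1 mulr1.
Qed.

Lemma kweight_moment a b :
  \int[unif2 R]_z (kweight z * (z.1 ^+ a * z.2 ^+ b)) = kmoment Kk a * kmoment K1 b.
Proof.
rewrite -!Rintegral_kext// -Rintegral_unif2; [|exact: bddm_kext..].
by apply: eq_Rintegral => z _; rewrite /kweight mulrACA.
Qed.

(** The factor $1-(-1)^b$ is 0 or 2 and removes the even moments of [K1], on which nothing is
    assumed beyond order 0; the conditions on its odd moments leave $b=1$, and those on [Kk] leave
    $a=k$. *)
Lemma kweight_odd_moment a b : (a <= n)%N -> (b <= n)%N ->
  \int[unif2 R]_z (kweight z * (z.1 ^+ a * z.2 ^+ b * (1 - (-1) ^+ b))) =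
  ((a == k) && (b == 1))%:R * (2 * k`!%:R).
Proof.
move=> an bn.
transitivity ((1 - (-1) ^+ b) * (kmoment Kk a * kmoment K1 b)).
  rewrite -kweight_moment -RintegralZl//; last exact: bddm_integrable (bddm_kweightX a b).
  by apply: eq_Rintegral => z _; rewrite mulrA mulrC.
case: hk h1 => _ K0 Kfact [_ _ K1odd K11].
have [->|/eqP ak] := eqVneq a k; last by rewrite K0// !(mul0r, mulr0).
rewrite Kfact -signr_odd; have [bo|be] := boolP (odd b); last first.
  by rewrite expr0 subrr mul0r; case: eqP be => [->//|_ _]; rewrite mul0r.
have [->|b1] := eqVneq b 1; first by rewrite K11 /= expr1 opprK; ring.
rewrite K1odd ?mulr0 ?mul0r// bn andbT.
by case: b bo b1 {an bn} => [|[|[|b]]].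
Qed.

Definition monomial (m : 'I_d -> nat) (u v : R) : R :=
  \prod_i ((h * u) *: unitv R j + (h * v) *: unitv R l) 0 i ^+ m i.

Lemma monomialE m u v : monomial m u v =
  \prod_i (h * (u * (i == j)%:R + v * (i == l)%:R)) ^+ m i.
Proof.
apply: eq_bigr => i _; congr (_ ^+ _); rewrite !mxE !eqxx/=.
by rewrite -!mulrA -mulrDr.
Qed.

Lemma monomial0 m i u v : i != j -> i != l -> m i != 0%N -> monomial m u v = 0.
Proof.
move=> ij il mi; rewrite monomialE (bigD1 i)//= (negbTE ij) (negbTE il).
by rewrite !mulr0 addr0 mulr0 expr0n (negbTE mi) mul0r.
Qed.

(** The multi-index $ke_j+e_l$, which is $(k+1)e_j$ when $j=l$. *)
Let target (m : 'I_d -> nat) := [forall i, m i == ((i == j) * k + (i == l))%N].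

Let value (m : 'I_d -> nat) : R :=
  if target m then 2 * h ^+ k.+1 * (\prod_i (m i)`!)%N%:R else 0.

(** A multi-index charging a third coordinate gives a zero monomial. For $j=l$ the binomial formula
    splits $(u+v)^{m_j}$; for $j\ne l$ the monomial is already a product of powers.
    [kweight_odd_moment] then settles each term. *)
Let monomial_bddm_moment m : (\sum_i m i <= n)%N ->
  bddm (fun z : RT * RT => kweight z * (monomial m z.1 z.2 - monomial m z.1 (- z.2))) /\
  \int[unif2 R]_z (kweight z * (monomial m z.1 z.2 - monomial m z.1 (- z.2))) = value m.
Proof.
move=> mn.
have mjn i : (m i <= n)%N by apply: leq_trans mn; rewrite (bigD1 i)//= leq_addr.
have [/existsP[i /and3P[ij il mi]]|] := boolP [exists i, [&& i != j, i != l & m i != 0%N]].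
  have E : (fun z : RT * RT => kweight z * (monomial m z.1 z.2 - monomial m z.1 (- z.2))) =
    fun=> 0 by apply/funext => z; rewrite !(monomial0 _ _ ij il mi) subrr mulr0.
  rewrite E; split; first exact: bddm_cst.
  rewrite Rintegral_cst// mul0r /value ifF//; apply/negbTE/negP => /forallP/(_ i).
  by rewrite (negbTE ij) (negbTE il) (negbTE mi).
rewrite negb_exists => /forallP m0.
have {}m0 i : i != j -> i != l -> m i = 0%N.
  by move=> ij il; have := m0 i; rewrite ij il /= negbK => /eqP.
have [jl|jl] := eqVneq j l.
- pose c b : R := h ^+ m j * 'C(m j, b)%:R.
  have E : (fun z : RT * RT => kweight z * (monomial m z.1 z.2 - monomial m z.1 (- z.2))) =
    (fun z => \sum_(b < (m j).+1) c b *
       (kweight z * (z.1 ^+ (m j - b) * z.2 ^+ b * (1 - (-1) ^+ b)))).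
    have Em u v : monomial m u v = h ^+ m j * (u + v) ^+ m j.
      rewrite monomialE (bigD1 j)//= -jl eqxx !mulr1 exprMn big1 ?mulr1// => i ij.
      by rewrite m0 ?expr0// -jl.
    apply/funext => z; rewrite !Em !exprDn -mulrBr -sumrB mulrCA !mulr_sumr.
    apply: eq_bigr => b _; rewrite (exprNn z.2) /c.
    exact: even_odd_split.
  have bE (b : 'I_(m j).+1) : bddm (fun z : RT * RT => c b *
       (kweight z * (z.1 ^+ (m j - b) * z.2 ^+ b * (1 - (-1) ^+ b)))).
    apply: bddmM (bddm_cst _) _; under eq_fun do rewrite mulrA.
    by apply: bddmM (bddm_cst _); exact: bddm_kweightX.
  rewrite E; split; first exact: bddm_sum.
  rewrite Rintegral_bddm_sum//.
  have Ib (b : 'I_(m j).+1) : \int[unif2 R]_z (c b *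
       (kweight z * (z.1 ^+ (m j - b) * z.2 ^+ b * (1 - (-1) ^+ b)))) =
     c b * (((m j - b)%N == k) && (b == 1 :> nat))%:R * (2 * k`!%:R).
    rewrite RintegralZl//; last first.
      apply: bddm_integrable; under eq_fun do rewrite mulrA.
      by apply: bddmM (bddm_cst _); exact: bddm_kweightX.
    rewrite kweight_odd_moment ?mulrA//; first by rewrite (leq_trans (leq_subr _ _)).
    by rewrite (leq_trans (ltnSE (ltn_ord b))).
  rewrite (eq_bigr _ (fun b _ => Ib b)).
  have Et : target m = (m j == k.+1).
    apply/forallP/eqP => [/(_ j)|mj i]; first by rewrite -jl eqxx mul1n addn1 => /eqP.
    rewrite -jl; have [->|ij] := eqVneq i j; first by rewrite mul1n addn1 mj.
    by rewrite m0// -jl.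
  rewrite /value Et; have [mj|mj] := eqVneq (m j) k.+1; last first.
    rewrite big1// => b _.
    have [/andP[/eqP e /eqP b1]|_] := boolP (((m j - b)%N == k) && (b == 1 :> nat)).
      have := ltn_ord b; rewrite b1 ltnS => mj0.
      by case/eqP: mj; rewrite -e b1 subn1 prednK.
    by rewrite mulr0 mul0r.
  (* The term $b=1$ carries the binomial coefficient $k+1$, which turns the $k!$ of the kernel into
     the $(k+1)!$ of the multi-index. *)
  have H1 : (1 < (m j).+1)%N by rewrite mj.
  rewrite (bigD1 (Ordinal H1))//= big1 => [|b b1]; last first.
    have -> : (b == 1 :> nat) = false by apply/negbTE; move: b1; rewrite -val_eqE.
    by rewrite andbF mulr0 mul0r.
  rewrite addr0 mj subn1 /= eqxx /c mj bin1 (bigD1 j)//= big1 => [|i ij].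
    by rewrite muln1 mj factS natrM; ring.
  by rewrite m0// -jl.
- have Em u v : monomial m u v = h ^+ (m j + m l) * (u ^+ m j * v ^+ m l).
    rewrite monomialE (bigD1 j)//= (bigD1 l)/=; last by rewrite eq_sym.
    rewrite eqxx (negbTE jl) eq_sym (negbTE jl) eqxx !mulr1 !mulr0 addr0 add0r.
    rewrite big1 => [|i /andP[ij il]]; last by rewrite m0.
    by rewrite mulr1 !exprMn exprD; ring.
  have E : (fun z : RT * RT => kweight z * (monomial m z.1 z.2 - monomial m z.1 (- z.2))) =
    (fun z => h ^+ (m j + m l) *
       (kweight z * (z.1 ^+ m j * z.2 ^+ m l * (1 - (-1) ^+ m l)))).
    by apply/funext => z; rewrite !Em (exprNn z.2); exact: odd_split.
  have b0 : bddm (fun z : RT * RT =>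
       (kweight z * (z.1 ^+ m j * z.2 ^+ m l * (1 - (-1) ^+ m l)))).
    under eq_fun do rewrite mulrA.
    by apply: bddmM (bddm_cst _); exact: bddm_kweightX.
  rewrite E; split; first exact: bddmM (bddm_cst _) b0.
  rewrite RintegralZl//; last exact: bddm_integrable.
  rewrite kweight_odd_moment//.
  have Et : target m = (m j == k) && (m l == 1).
    apply/forallP/andP => [H|[/eqP mj /eqP ml] i].
      have := H j; have := H l; rewrite !eqxx (eq_sym l) (negbTE jl) mul1n addn0 => -> ->.
      by [].
    have [->|ij] := eqVneq i j; first by rewrite (negbTE jl) mul1n addn0 mj.
    have [->|il] := eqVneq i l; first by rewrite ml.
    by rewrite m0.
  rewrite /value Et; case: ifP => [/andP[/eqP mj /eqP ml]|]; last by rewrite mul0r mulr0.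
  rewrite mul1r (bigD1 j)//= (bigD1 l)/=; last by rewrite eq_sym.
  rewrite big1 => [|i /andP[ij il]]; last by rewrite m0.
  by rewrite mj ml addn1 !muln1; ring.
Qed.

Lemma bddm_monomial m : (\sum_i m i <= n)%N ->
  bddm (fun z : RT * RT => kweight z * (monomial m z.1 z.2 - monomial m z.1 (- z.2))).
Proof. by case/monomial_bddm_moment. Qed.

Lemma monomial_moment m : (\sum_i m i <= n)%N ->
  \int[unif2 R]_z (kweight z * (monomial m z.1 z.2 - monomial m z.1 (- z.2))) =
  if [forall i, m i == ((i == j) * k + (i == l))%N]
  then 2 * h ^+ k.+1 * (\prod_i (m i)`!)%N%:R else 0.
Proof. by case/monomial_bddm_moment. Qed.

End QueryMoments.

Section Estimator.
Variables (R : realType) (d : nat) (j l : 'I_d) (k n : nat) (Kk K1 : R -> R).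
Variables (h b L Gg : R) (S : set 'rV[R]_d) (g : 'rV[R]_d -> R) (x : 'rV[R]_d).
Hypotheses (h0 : 0 < h) (hle1 : h <= 1) (L0 : 0 <= L) (b0 : 0 <= b).
Hypotheses (hk : kernel_k n k Kk) (h1 : kernel_1 n K1) (kn : (k < n)%N).
Hypothesis gn : Cn n g.
Hypothesis gtaylor : forall x z, `|g z - taylor n g x z| <= L * enorm (z - x) `^ b.
Hypothesis gGg : forall x, fattening S x -> enorm (grad g x) <= Gg.
Hypothesis Sx : S x.
Let RT := measurableTypeR R.

Let W := @kweight R Kk K1.
Let mono := @monomial R d j l h.

Let bKk : bounded_kernel Kk. Proof. by case: hk. Qed.
Let bK1 : bounded_kernel K1. Proof. by case: h1. Qed.
Let bW : bddm W. Proof. exact: bddm_kweight hk h1. Qed.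

Lemma continuous_Cn : continuous g.
Proof. by have [] := gn (isT : (size (@nil 'I_d) <= n)%N). Qed.

Lemma derivable_Cn i y : derivable g y (unitv R i).
Proof.
have [_ /(_ _ i y)] := gn (isT : (size (@nil 'I_d) <= n)%N); apply.
exact: leq_ltn_trans kn.
Qed.

Definition finite_diff (z : RT * RT) : R :=
  g (x + (h * z.1) *: unitv R j + (h * z.2) *: unitv R l) -
  g (x + (h * z.1) *: unitv R j - (h * z.2) *: unitv R l).

Lemma measurable_query (s : R) :
  measurable_fun setT (fun z : RT * RT =>
    g (x + (h * z.1) *: unitv R j + (s * (h * z.2)) *: unitv R l)).
Proof.
apply: measurable_comp_rV => [|i]; first exact: continuous_Cn.
under eq_fun do rewrite !mxE.
apply: measurable_funD; first apply: measurable_funD => //.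
- by apply: measurable_funM => //; apply: measurable_funM => //; exact: measurable_fst.
- apply: measurable_funM => //; apply: measurable_funM => //.
  by apply: measurable_funM => //; exact: measurable_snd.
Qed.

Lemma measurable_finite_diff : measurable_fun setT finite_diff.
Proof.
apply: measurable_funB.
  by have := measurable_query 1; under eq_fun do rewrite mul1r.
by have := measurable_query (-1); under eq_fun do rewrite mulN1r scaleNr.
Qed.

(** Kernels are extended by zero, so a nonzero weight already confines both variables to
    $[-1/2,1/2]$; bounds on [g] are then needed only there, and hold pointwise. *)
Lemma kweight_out z : W z != 0 -> `|z.1| <= 1 / 2 /\ `|z.2| <= 1 / 2.
Proof.
rewrite /W /kweight mulf_eq0 negb_or => /andP[z1 z2]; split.
  by apply: kitv_norm; apply: contraPP z1 => /kext_out ->; rewrite eqxx.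
by apply: kitv_norm; apply: contraPP z2 => /kext_out ->; rewrite eqxx.
Qed.

Let Gg0 : 0 <= Gg.
Proof.
apply: le_trans (enorm_ge0 (grad g x)) (gGg _).
rewrite /fattening/= /dist; apply: le_trans (_ : enorm (x - x) <= 1).
  by apply: ge_inf; [exists 0 => _ [y Sy <-]; exact: enorm_ge0|exists x].
by rewrite subrr /enorm -[0](scale0r 0) dotvZl mul0r sqrtr0.
Qed.

Lemma finite_diff_le z : W z != 0 -> `|finite_diff z| <= h * Gg.
Proof.
move=> /kweight_out[z1 z2].
apply: (@query_difference_le _ _ S) => //; first by move=> y; exact: derivable_Cn.
by rewrite ltW.
Qed.

Lemma bddm_finite_diff : bddm (fun z => W z * finite_diff z).
Proof.
have [mW [M WM]] := bW; split; first exact: measurable_funM measurable_finite_diff.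
exists (M * (h * Gg)) => z; rewrite normrM.
have [->|Wz] := eqVneq (W z) 0.
  rewrite normr0 mul0r !mulr_ge0//; last exact: ltW.
  exact: le_trans (normr_ge0 _) (WM z).
by rewrite ler_pM// finite_diff_le.
Qed.

Let coef (m : {ffun 'I_d -> 'I_n.+1}) : R :=
  (\prod_i (m i)`!)%N%:R^-1 * Dmulti m g x.

Let taylor_diff (z : RT * RT) : R :=
  \sum_(m : {ffun 'I_d -> 'I_n.+1} | (\sum_i m i <= n)%N)
    coef m * (mono (fun i => m i) z.1 z.2 - mono (fun i => m i) z.1 (- z.2)).

Let taylor_diffE z : taylor_diff z =
  taylor n g x (x + (h * z.1) *: unitv R j + (h * z.2) *: unitv R l) -
  taylor n g x (x + (h * z.1) *: unitv R j - (h * z.2) *: unitv R l).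
Proof.
rewrite /taylor -sumrB; apply: eq_bigr => m _; rewrite -mulrBr; congr (_ * (_ - _)).
  by apply: eq_bigr => i _; congr (fun_of_matrix _ _ _ ^+ _);
    rewrite -[x + _ + _]addrA [x + (_ + _)]addrC addrK.
apply: eq_bigr => i _; congr (fun_of_matrix _ _ _ ^+ _).
by rewrite -[x + _ - _]addrA [x + (_ + _)]addrC addrK mulrN scaleNr.
Qed.

Let bddm_term (m : {ffun 'I_d -> 'I_n.+1}) : (\sum_i m i <= n)%N ->
  bddm (fun z => W z * (coef m * (mono (fun i => m i) z.1 z.2 - mono (fun i => m i) z.1 (- z.2)))).
Proof.
move=> mn; under eq_fun do rewrite mulrCA.
by apply: bddmM (bddm_cst _) _; exact: (@bddm_monomial _ _ j l k n Kk K1 h hk h1 (fun i => m i) mn).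
Qed.

(** Only $m=ke_j+e_l$ survives the integration, and its factorial cancels the one in the Taylor
    coefficient. *)
Let taylor_diff_moment : bddm (fun z => W z * taylor_diff z) /\
  \int[unif2 R]_z (W z * taylor_diff z) = 2 * h ^+ k.+1 * pd l (pdn k j g) x.
Proof.
have E : (fun z => W z * taylor_diff z) = fun z =>
    \sum_(m : {ffun 'I_d -> 'I_n.+1} | (\sum_i m i <= n)%N)
      W z * (coef m * (mono (fun i => m i) z.1 z.2 - mono (fun i => m i) z.1 (- z.2))).
  by apply/funext => z; rewrite /taylor_diff mulr_sumr.
rewrite E; split; first by apply: bddm_sum => m mn; exact: bddm_term.
rewrite Rintegral_bddm_sum//.
(* The entries fit in ['I_n.+1] since $k+1\le n$. *)
have target_lt i : (((i == j) * k + (i == l))%N < n.+1)%N.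
  by rewrite ltnS; case: (i == j); case: (i == l); rewrite ?mul1n ?mul0n ?addn1 ?addn0//;
    rewrite ?(ltnW kn)// (leq_ltn_trans _ kn).
pose ms : {ffun 'I_d -> 'I_n.+1} := [ffun i => Ordinal (target_lt i)].
have msE i : (ms i : nat) = ((i == j) * k + (i == l))%N by rewrite ffunE.
have sms : (\sum_i ms i <= n)%N.
  rewrite (eq_bigr (fun i => (i == j) * k + (i == l))%N); last by move=> i _; rewrite msE.
  rewrite big_split/= -big_distrl/=.
  have one a : (\sum_(i < d) (i == a) = 1)%N.
    rewrite (bigD1 a)//= eqxx big1 ?addn0// => i ia.
    by rewrite (negbTE ia).
  by rewrite !one mul1n addn1.
have I (m : {ffun 'I_d -> 'I_n.+1}) : (\sum_i m i <= n)%N ->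
    \int[unif2 R]_z (W z * (coef m *
      (mono (fun i => m i) z.1 z.2 - mono (fun i => m i) z.1 (- z.2)))) =
    coef m * if [forall i, (m i : nat) == ((i == j) * k + (i == l))%N]
      then 2 * h ^+ k.+1 * (\prod_i (m i)`!)%N%:R else 0.
  move=> mn; rewrite -(@monomial_moment _ _ j l k n Kk K1 h hk h1 (fun i => m i) mn).
  rewrite -RintegralZl//; last first.
    by apply: bddm_integrable; exact: (@bddm_monomial _ _ j l k n Kk K1 h hk h1 (fun i => m i) mn).
  by apply: eq_Rintegral => z _; rewrite mulrCA.
rewrite (bigD1 ms)//= [X in _ + X]big1 ?addr0 => [|m /andP[mn mms]].
  rewrite I// ifT; last by apply/forallP => i; rewrite msE.
  rewrite /coef (Dmulti_axis gn kn msE).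
  have : ((\prod_i (ms i)`!)%N%:R : R) != 0.
    by rewrite pnatr_eq0 -lt0n prodn_gt0// => i; exact: fact_gt0.
  move: ((\prod_i _)%N%:R) (pd l _ x) (2 * h ^+ _) => p D c p0.
  by rewrite [c * p]mulrC mulrACA mulVf// mul1r mulrC.
rewrite I// ifF ?mulr0//; apply/negbTE; apply: contra mms => /forallP H.
by apply/eqP/ffunP => i; apply/val_inj; rewrite /= msE; exact/eqP.
Qed.

(** Both queries are within $h(|u|+|v|)\le h$ of [x]; the factor 2 counts two Taylor remainders. *)
Let remainder_le z : W z != 0 ->
  `|finite_diff z - taylor_diff z| <= 2 * (L * h `^ b).
Proof.
move=> /kweight_out[z1 z2]; rewrite taylor_diffE /finite_diff.
set p := x + _ + _; set q := x + _ - _.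
have -> : g p - g q - (taylor n g x p - taylor n g x q) =
  (g p - taylor n g x p) - (g q - taylor n g x q).
  by move: (g p) (g q) (taylor _ _ _ p) (taylor _ _ _ q) => A B C D; ring.
have bd y : enorm (y - x) <= h -> `|g y - taylor n g x y| <= L * h `^ b.
  move=> yh; apply: le_trans (gtaylor _ _) _.
  by rewrite ler_wpM2l// ge0_ler_powR// ?nnegrE ?enorm_ge0// ltW.
have bd2 u v : `|u| <= 1 / 2 -> `|v| <= 1 / 2 ->
    enorm (x + (h * u) *: unitv R j + (h * v) *: unitv R l - x) <= h.
  move=> u1 v1; rewrite -[x + _ + _]addrA [x + (_ + _)]addrC addrK.
  have h0' := ltW h0.
  rewrite -ler_sqr ?nnegrE ?enorm_ge0// enorm_sqr.
  apply: le_trans (dotv_unitv _ _ _ _) _.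
  rewrite ler_sqr ?nnegrE ?addr_ge0// !normrM gtr0_norm//.
  by rewrite -mulrDr ger_pMr//; lra.
apply: le_trans (ler_normB _ _) _; rewrite mulr_natl mulr2n lerD//; apply: bd.
  exact: bd2.
by rewrite /q -scaleNr -mulrN; apply: bd2; rewrite ?normrN.
Qed.

(** Cauchy-Schwarz for each kernel separately, the origin of the two square roots in [Cbias]. *)
Let int_norm_kweight :
  \int[unif2 R]_z `|W z| <= Num.sqrt (ksq Kk) * Num.sqrt (ksq K1).
Proof.
have -> : \int[unif2 R]_z `|W z| = \int[unif2 R]_z (`|kext Kk z.1| * `|kext K1 z.2|).
  by apply: eq_Rintegral => z _; rewrite normrM.
have b1 := bddm_kext0 bKk; have b2 := bddm_kext0 bK1.
rewrite (@Rintegral_unif2 R (fun u => `|kext Kk u|) (fun v => `|kext K1 v|));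
  [|exact: bddm_norm..].
rewrite !ksqE; apply: ler_pM; rewrite ?Rintegral_norm_le_sqrt//.
  by apply: Rintegral_ge0.
by apply: Rintegral_ge0.
Qed.

(** The Taylor polynomial contributes exactly the target, so the error is the remainder integrated
    against the absolute weight. *)
Lemma finite_diff_bias :
  `|\int[unif2 R]_z (W z * finite_diff z) - 2 * h ^+ k.+1 * pd l (pdn k j g) x| <=
  2 * (Cbias L Kk K1 * h `^ b).
Proof.
have [bT <-] := taylor_diff_moment.
have bD := bddm_finite_diff.
rewrite -RintegralB//; [|exact: bddm_integrable..].
have bR : bddm (fun z => W z * finite_diff z - W z * taylor_diff z).
  apply: bddmD => //; under eq_fun do rewrite -mulN1r.
  exact: bddmM (bddm_cst _) bT.
apply: le_trans (le_normr_Rintegral _ _) _ => //; first exact: bddm_integrable.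
have bN := bddm_norm bW.
apply: le_trans (_ : \int[unif2 R]_z ((2 * (L * h `^ b)) * `|W z|) <= _).
  apply: le_Rintegral => //.
  - exact: bddm_integrable (bddm_norm bR).
  - by apply: bddm_integrable; exact: bddmM (bddm_cst _) bN.
  move=> z _; rewrite -mulrBr normrM mulrC.
  have [->|Wz] := eqVneq (W z) 0; first by rewrite normr0 !mulr0.
  by rewrite ler_wpM2r// remainder_le.
rewrite RintegralZl//; last exact: bddm_integrable.
have hb := powR_ge0 h b.
have : 2 * (L * h `^ b) * \int[unif2 R]_z `|W z| <=
  2 * (L * h `^ b) * (Num.sqrt (ksq Kk) * Num.sqrt (ksq K1)).
  by apply: ler_wpM2l int_norm_kweight; rewrite !mulr_ge0.
move/le_trans; apply; rewrite /Cbias.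
by move: (h `^ b) (Num.sqrt _) (Num.sqrt _) => A B C; rewrite le_eqVlt; apply/orP; left;
  apply/eqP; ring.
Qed.

(** One coordinate of the estimator as a function of the random pair alone; the query point and the
    two noise values are parameters. *)
Definition kernel_estimate (ep em : R) (z : RT * RT) : R :=
  kext Kk z.1 * kext K1 z.2 / (2 * h ^+ k.+1) *
  ((g (x + (h * z.1) *: unitv R j + (h * z.2) *: unitv R l) + ep) -
   (g (x + (h * z.1) *: unitv R j - (h * z.2) *: unitv R l) + em)).

Let kernel_estimateE ep em z : kernel_estimate ep em z =
  (2 * h ^+ k.+1)^-1 * (W z * finite_diff z + (ep - em) * W z).
Proof.
rewrite /kernel_estimate /finite_diff /W /kweight.
move: (g _) (g _) (kext _ _) (kext _ _) (_^-1) => A B C D E; ring.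
Qed.

Lemma bddm_kernel_estimate ep em : bddm (kernel_estimate ep em).
Proof.
rewrite (funext (kernel_estimateE ep em)).
apply: bddmM (bddm_cst _) _; apply: bddmD; first exact: bddm_finite_diff.
exact: bddmM (bddm_cst _) bW.
Qed.

(** Frozen noise multiplies the mean of the weight, which is zero as $\int K_1=0$. Division by
    $2h^{k+1}$ lowers $h^b$ to $h^{b-k-1}$, that is $h^{\beta-1}$ for $b=\beta+k$. *)
Lemma kernel_estimate_bias ep em : 1 <= b - k%:R ->
  `|\int[unif2 R]_z (kernel_estimate ep em z) - pd l (pdn k j g) x| <=
  Cbias L Kk K1 * h `^ (b - k%:R - 1).
Proof.
move=> bk.
under eq_Rintegral do rewrite kernel_estimateE.
have iD := bddm_integrable (unif2 R) bddm_finite_diff.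
have bE := bddmM (bddm_cst (ep - em)) bW.
rewrite RintegralZl//; last exact: bddm_integrable (bddmD bddm_finite_diff bE).
rewrite RintegralD//; last exact: bddm_integrable bE.
rewrite RintegralZl//; last exact: bddm_integrable.
have -> : \int[unif2 R]_z (W z) = 0.
  transitivity (kmoment Kk 0 * kmoment K1 0).
    by rewrite -(kweight_moment hk h1); apply: eq_Rintegral => z _; rewrite !expr0 !mulr1.
  by case: h1 => _ -> _ _; rewrite mulr0.
rewrite mulr0 addr0.
have hk0 : 0 < 2 * h ^+ k.+1 by rewrite mulr_gt0// exprn_gt0.
have hV0 : 0 <= (2 * h ^+ k.+1)^-1 by rewrite invr_ge0 ltW.
have := ler_wpM2l hV0 finite_diff_bias.
rewrite -{1}[(2 * h ^+ k.+1)^-1]gtr0_norm ?invr_gt0// -normrM mulrBr mulKf ?gt_eqF//.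
move=> /le_trans; apply; rewrite le_eqVlt; apply/orP; left; apply/eqP.
have -> : h `^ b = h ^+ k.+1 * h `^ (b - k%:R - 1).
  rewrite -powR_mulrn ?ltW// -powRD; last by rewrite (gt_eqF h0) implybT.
  by congr (_ `^ _); rewrite -natr1; ring.
have hk1 : h ^+ k.+1 != 0 by rewrite expf_neq0// gt_eqF.
move: hk1; move: (h ^+ k.+1) (h `^ _) (Cbias _ _ _) => A B C A0.
by field.
Qed.

(** Kept pointwise because it also dominates the random increment in the integrability proof. The
    constants come from $(D+e)^2\le2D^2+2e^2$ with $e=\varepsilon^+-\varepsilon^-$, from
    $e^2\le2(\varepsilon^+)^2+2(\varepsilon^-)^2$, and from $hG_g\le G_g$. *)
Lemma kernel_estimate_sqr_le ep em z :
  kernel_estimate ep em z ^+ 2 <= (2 * h ^+ k.+1) ^- 2 *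
    (2 * Gg ^+ 2 + 4 * ep ^+ 2 + 4 * em ^+ 2) * W z ^+ 2.
Proof.
have H0 : 0 < 2 * h ^+ k.+1 by rewrite mulr_gt0// exprn_gt0.
rewrite kernel_estimateE exprMn exprVn -mulrA ler_wpM2l//.
  by rewrite invr_ge0 exprn_ge0// ltW.
have [->|Wz] := eqVneq (W z) 0.
  by rewrite mul0r mulr0 addr0 !expr0n/= mulr0.
have := finite_diff_le Wz.
have hG : h * Gg <= Gg by rewrite ler_piMl.
move=> /le_trans /(_ hG) D.
have {}D : finite_diff z ^+ 2 <= Gg ^+ 2.
  by rewrite -real_normK ?num_real// ler_sqr ?nnegrE.
rewrite [(ep - em) * _]mulrC -mulrDr exprMn mulrC ler_wpM2r ?sqr_ge0//.
move: D; move: (finite_diff z) => D h2.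
have := sqr_ge0 (D - (ep - em)); have := sqr_ge0 (ep + em).
rewrite !expr2 in h2 *; lra.
Qed.

Lemma kernel_estimate_sqr ep em :
  \int[unif2 R]_z (kernel_estimate ep em z ^+ 2) <=
  ksq Kk * ksq K1 / (4 * h ^+ (2 * k.+1)) *
    (2 * Gg ^+ 2 + 4 * ep ^+ 2 + 4 * em ^+ 2).
Proof.
set c := 2 * Gg ^+ 2 + 4 * ep ^+ 2 + 4 * em ^+ 2.
have bW2 : bddm (fun z : RT * RT => kext Kk z.1 ^+ 2 * kext K1 z.2 ^+ 2).
  by under eq_fun do rewrite -exprMn; exact: bddmX.
apply: le_trans (_ : \int[unif2 R]_z (((2 * h ^+ k.+1) ^- 2 * c) *
    (kext Kk z.1 ^+ 2 * kext K1 z.2 ^+ 2)) <= _).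
  apply: le_Rintegral => //.
  - by apply: bddm_integrable; apply: bddmX; exact: bddm_kernel_estimate.
  - by apply: bddm_integrable; exact: bddmM (bddm_cst _) bW2.
  by move=> z _; rewrite -exprMn; exact: kernel_estimate_sqr_le.
rewrite RintegralZl//; last exact: bddm_integrable.
rewrite (@Rintegral_unif2 R (fun u => kext Kk u ^+ 2) (fun v => kext K1 v ^+ 2));
  [|exact: bddmX (bddm_kext0 _)..].
rewrite -!ksqE exprMn (mulnC 2) exprM.
have := exprn_gt0 k.+1 h0; move: (h ^+ k.+1) (ksq Kk) (ksq K1) => A B C A0.
rewrite le_eqVlt; apply/orP; left; apply/eqP; field.
by rewrite gt_eqF.
Qed.

End Estimator.

(** * Independence from the past *)

Section Independence.
Context {R : realType} {dO : measure_display} {Omega : measurableType dO}.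
Variable P : probability Omega R.
Variables (I J : finType) (X : I -> {RV P >-> R}) (Y : J -> {RV P >-> R}).
Hypotheses (indX : mutually_independent X) (indXY : independent_families X Y).
Variable S : {set I}.
Let RT := measurableTypeR R.

(** Generators of the sigma-algebra to be frozen: the randomization variables indexed by [S], and
    every noise variable whatever its step. *)
Definition history : set (set Omega) :=
  [set A | (exists i B, [/\ i \in S, measurable B & A = X i @^-1` B]) \/
           (exists i B, measurable B /\ A = Y i @^-1` B)].

Let mX i (B : set R) : measurable B -> measurable (X i @^-1` B).
Proof. by move=> mB; rewrite -[X in measurable X]setTI; exact: measurable_funPT. Qed.

Let mY i (B : set R) : measurable B -> measurable (Y i @^-1` B).
Proof. by move=> mB; rewrite -[X in measurable X]setTI; exact: measurable_funPT. Qed.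

Lemma history_measurable : history `<=` measurable.
Proof. by move=> _ [[i [B [_ mB ->]]]|[i [B [mB ->]]]]; [exact: mX|exact: mY]. Qed.

Lemma sigma_rv_measurable : sigma_rv Y `<=` measurable.
Proof.
apply: smallest_sub; first exact: sigma_algebra_measurable.
by move=> _ [i [B [mB ->]]]; exact: mY.
Qed.

(** Viewed as measurable types, the two generated sigma-algebras inherit the closure lemmas for
    measurable sets. *)
Let sX := g_sigma_algebraType [set A | exists i B, measurable B /\ A = X i @^-1` B].
Let sY := g_sigma_algebraType [set A | exists i B, measurable B /\ A = Y i @^-1` B].

Let msX i (B : set R) : measurable B -> measurable (X i @^-1` B : set sX).
Proof. by move=> mB; apply: sub_sigma_algebra; exists i, B. Qed.

Let cyl (Bf : I -> set R) : set Omega := \bigcap_(i in [set` S]) X i @^-1` Bf i.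

(* Cylinders over [S] intersected with noise events generate the history and
   are closed under intersection, so product rules extend from them. *)
Let pis : set (set Omega) := [set A | exists Bf F,
  [/\ forall i, measurable (Bf i), sigma_rv Y F & A = cyl Bf `&` F]].

Let pis_measurable : pis `<=` measurable.
Proof.
move=> _ [Bf [F [mB mF ->]]]; apply: measurableI; last exact: sigma_rv_measurable.
by apply: fin_bigcap_measurable => [|i _]; [exact: finite_finset|exact: mX].
Qed.

Let pis_setI : setI_closed pis.
Proof.
move=> _ _ [B [F [mB mF ->]]] [B' [F' [mB' mF' ->]]].
exists (fun i => B i `&` B' i), (F `&` F'); split.
- by move=> i; exact: measurableI.
- exact: (@measurableI _ sY).
- rewrite setIACA; congr (_ `&` _); rewrite /cyl -bigcapI.
  by apply: eq_bigcapr => i _; rewrite preimage_setI.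
Qed.

Let cylT : cyl (fun=> setT) = setT.
Proof. by rewrite -subTset => w _ i _. Qed.

Let pisT : pis setT.
Proof.
exists (fun=> setT), setT; split=> //; first exact: (@measurableT _ sY).
by rewrite cylT setTI.
Qed.

Let history_pis : <<s history >> `<=` <<s pis >>.
Proof.
apply: smallest_sub; first exact: smallest_sigma_algebra.
move=> _ [[i [B [iS mB ->]]]|[i [B [mB ->]]]]; apply: sub_sigma_algebra.
- exists (fun j => if j == i then B else setT), setT; split.
  + by move=> j; case: ifP.
  + exact: (@measurableT _ sY).
  + rewrite setIT; apply/seteqP; split=> [w Bw j _|w /(_ i iS)]; last by rewrite eqxx.
    by case: ifP => // /eqP ->.
- exists (fun=> setT), (Y i @^-1` B); split=> //; last by rewrite cylT setTI.
  by apply: sub_sigma_algebra; exists i, B.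
Qed.

Variables (i1 i2 : I).
Hypotheses (i12 : i1 != i2) (i1S : i1 \notin S) (i2S : i2 \notin S).

(** Independence of the two families splits off the noise event [F], once with the rectangle and
    once without; mutual independence over [i1 |: (i2 |: S)] then factors the rest. *)
Let indep_rect_pis B1 B2 A : measurable B1 -> measurable B2 -> pis A ->
  (P ((X i1 @^-1` B1 `&` X i2 @^-1` B2) `&` A) =
   P (X i1 @^-1` B1) * P (X i2 @^-1` B2) * P A)%E.
Proof.
move=> mB1 mB2 [Bf [F [mB mF ->]]].
pose B i := if i == i1 then B1 else if i == i2 then B2 else Bf i.
have mBB i : measurable (B i) by rewrite /B; case: ifP => // _; case: ifP.
pose K := X i1 @^-1` B1 `&` X i2 @^-1` B2.
have KE : K `&` cyl Bf = \bigcap_(i in [set` i1 |: (i2 |: S)]) X i @^-1` B i.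
  apply/seteqP; split => [w [[w1 w2] wS] i /=|w H].
    rewrite !inE => /or3P[/eqP ->|/eqP ->|iS].
    - by rewrite /B eqxx.
    - by rewrite /B eq_sym (negbTE i12) eqxx.
    - rewrite /B; case: eqP => [->//|_]; case: eqP => [->//|_]; exact: wS.
  split; first split.
  - by have := H i1; rewrite /= !inE eqxx /B eqxx; apply.
  - by have := H i2; rewrite /= !inE eqxx orbT /B eq_sym (negbTE i12) eqxx; apply.
  - move=> i iS; have := H i; rewrite /= !inE iS !orbT => /(_ isT).
    rewrite /B; case: eqP => [i1E|_]; first by move: i1S; rewrite -i1E iS.
    by case: eqP => [i2E|_//]; move: i2S; rewrite -i2E iS.
have sKE : sigma_rv X (K `&` cyl Bf).
  rewrite KE; apply: (@fin_bigcap_measurable _ sX) => [|i _]; first exact: finite_finset.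
  exact: msX.
have scyl : sigma_rv X (cyl Bf).
  apply: (@fin_bigcap_measurable _ sX) => [|i _]; first exact: finite_finset.
  exact: msX.
rewrite setIA -/K (indXY sKE mF) (indXY scyl mF) KE indX// /cyl indX// !muleA; congr (_ * _)%E.
rewrite big_setU1/=; last by rewrite !inE negb_or i12.
rewrite big_setU1//= {1}/B eqxx {1}/B eq_sym (negbTE i12) eqxx muleA; congr (_ * _)%E.
apply: eq_bigr => i iS; rewrite /B; case: eqP => [i1E|_]; first by move: i1S; rewrite -i1E iS.
by case: eqP => [i2E|_//]; move: i2S; rewrite -i2E iS.
Qed.

(** For fixed [B1] and [B2] both sides are finite measures of [C] that agree on [pis], hence on the
    sigma-algebra it generates. *)
Let indep_rect B1 B2 C : measurable B1 -> measurable B2 -> <<s history >> C ->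
  (P ((X i1 @^-1` B1 `&` X i2 @^-1` B2) `&` C) =
   P (X i1 @^-1` B1) * P (X i2 @^-1` B2) * P C)%E.
Proof.
move=> mB1 mB2 /history_pis sC.
have mK : measurable (X i1 @^-1` B1 `&` X i2 @^-1` B2) by apply: measurableI; exact: mX.
pose m1 := mrestr P mK.
have fp : (P (X i1 @^-1` B1) * P (X i2 @^-1` B2))%E \is a fin_num.
  by rewrite fin_numM// fin_num_measure//; exact: mX.
have p0 : 0 <= fine (P (X i1 @^-1` B1) * P (X i2 @^-1` B2))%E.
  by rewrite fine_ge0// mule_ge0.
pose m2 := mscale (NngNum p0) P.
have := @g_sigma_algebra_measure_unique _ _ _ pis pis_measurable (fun=> setT)
  (fun=> pisT) _ m1 m2 pis_setI _ _ C sC.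
have E1 D : m1 D = P ((X i1 @^-1` B1 `&` X i2 @^-1` B2) `&` D) by rewrite setIC.
have E2 D : m2 D = (P (X i1 @^-1` B1) * P (X i2 @^-1` B2) * P D)%E.
  by rewrite /m2 /mscale/= fineK.
move=> H; rewrite -E1 -E2; apply: H.
- by rewrite bigcup_const.
- move=> A pA; apply: etrans (E1 A) _; apply: etrans _ (esym (E2 A)).
  exact: indep_rect_pis.
- move=> _; suff : (P ((X i1 @^-1` B1 `&` X i2 @^-1` B2) `&` setT) < +oo)%E by rewrite -E1.
  by rewrite setIT; apply: le_lt_trans (probability_le1 P _) (ltry _).
Qed.

(** A second uniqueness argument, with [C] fixed and [A] varying: rectangles generate the product
    sigma-algebra. *)
Lemma pair_independent (mu1 mu2 : probability RT R) :
  (forall B, measurable B -> P (X i1 @^-1` B) = mu1 B) ->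
  (forall B, measurable B -> P (X i2 @^-1` B) = mu2 B) ->
  forall (A : set (RT * RT)) C, measurable A -> <<s history >> C ->
  (P ((fun w => (X i1 w, X i2 w)) @^-1` A `&` C) = (mu1 \x mu2)%E A * P C)%E.
Proof.
move=> law1 law2 A C mA sC.
have mC : measurable C.
  by move: sC; apply: smallest_sub; [exact: sigma_algebra_measurable|exact: history_measurable].
pose XX : Omega -> RT * RT := fun w => (X i1 w, X i2 w).
have mXX : measurable_fun setT XX.
  by apply: measurable_fun_pair;
    [exact (measurable_funPT (X i1))|exact (measurable_funPT (X i2))].
pose m1' : {measure set (RT * RT) -> \bar R} :=
  pushforward (mrestr P mC) XX.
pose m1 := m1' mXX.
have p0 : 0 <= fine (P C) by rewrite fine_ge0.
pose m2 := mscale (NngNum p0) (mu1 \x mu2)%E.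
have fC : P C \is a fin_num by exact: fin_num_measure.
pose rect := [set B1 `*` B2 | B1 in @measurable _ RT & B2 in @measurable _ RT].
have := @g_sigma_algebra_measure_unique _ _ _ rect _ (fun=> setT) _ _ m1 m2 _ _ _ A.
have E1 D : m1 D = P (XX @^-1` D `&` C) by [].
have E2 D : m2 D = ((mu1 \x mu2) D * P C)%E by rewrite /m2 /mscale/= fineK// muleC.
move=> H; rewrite -E1 -E2; apply: H.
- by move=> _ [B1 mB1 [B2 mB2 <-]]; exact: measurableX.
- by move=> _; exists setT => //; exists setT => //; rewrite setXTT.
- by rewrite bigcup_const.
- move=> _ _ [B1 mB1 [B2 mB2 <-]] [B1' mB1' [B2' mB2' <-]].
  rewrite -setXI; exists (B1 `&` B1'); first exact: measurableI.
  by exists (B2 `&` B2') => //; exact: measurableI.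
- move=> _ [B1 mB1 [B2 mB2 <-]].
  apply: etrans (E1 _) _; apply: etrans _ (esym (E2 _)).
  apply: etrans (indep_rect mB1 mB2 sC) _; congr (_ * _)%E.
  by rewrite (law1 _ mB1) (law2 _ mB2); apply: esym; exact: product_measure1E.
- move=> _; suff : (P (XX @^-1` setT `&` C) < +oo)%E by rewrite -E1.
  by rewrite preimage_setT setTI; apply: le_lt_trans (probability_le1 P _) (ltry _).
- by rewrite -measurable_prod_measurableType.
Qed.

End Independence.

(** * One step of the algorithm *)

Lemma measurable_fun_coarser (d d' : measure_display) (T : measurableType d)
    (T' : measurableType d') (G : set (set T)) (f : T -> T') :
  G `<=` measurable ->
  measurable_fun setT (f : g_sigma_algebraType G -> T') -> measurable_fun setT f.
Proof.
move=> GM mf _ B mB; rewrite setTI.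
have : measurable (f @^-1` B : set (g_sigma_algebraType G)).
  by rewrite -[X in measurable X]setTI; exact: mf.
by apply: smallest_sub => //; exact: sigma_algebra_measurable.
Qed.

Lemma Cn_continuous_pd (R : realType) (d n k : nat) (j l : 'I_d) (g : 'rV[R]_d -> R) :
  Cn n g -> (k < n)%N -> continuous (pd l (pdn k j g)).
Proof.
move=> gn kn; rewrite pdn_pd_seq.
by have [|] := gn (l :: nseq k j); rewrite /= ?size_nseq.
Qed.

(** All arguments vary with the sample point, so that this serves the recursion of the iterates as
    well as the product space used for freezing. *)
Lemma measurable_kernel_estimate (R : realType) (d : nat) (j l : 'I_d) (k : nat)
    (Kk K1 : R -> R) (h : R) (g : 'rV[R]_d -> R)
    (dT : measure_display) (T : measurableType dT)
    (X : T -> 'rV[R]_d) (e1 e2 u v : T -> R) :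
  bounded_kernel Kk -> bounded_kernel K1 -> continuous g ->
  (forall i, measurable_fun setT (fun w => X w 0 i)) ->
  measurable_fun setT e1 -> measurable_fun setT e2 ->
  measurable_fun setT u -> measurable_fun setT v ->
  measurable_fun setT (fun w =>
    kernel_estimate j l k Kk K1 h g (X w) (e1 w) (e2 w) (u w, v w)).
Proof.
move=> bKk bK1 cg mX me1 me2 mu mv.
have mK K (p : T -> R) : bounded_kernel K -> measurable_fun setT p ->
    measurable_fun setT (fun w => kext K (p w)).
  by move=> bK mp; apply: (measurableT_comp (bddm_kext0 bK).1).
have mq (s : R) : measurable_fun setT (fun w =>
    g (X w + (h * u w) *: unitv R j + (s * (h * v w)) *: unitv R l)).
  apply: measurable_comp_rV => // i; under eq_fun do rewrite !mxE.
  apply: measurable_funD; first apply: measurable_funD => //.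
    by do 2 apply: measurable_funM => //.
  by do 3 apply: measurable_funM => //.
apply: measurable_funM.
  apply: measurable_funM; last exact: measurable_cst.
  by apply: measurable_funM; exact: mK.
apply: measurable_funB; apply: measurable_funD => //.
  by have := mq 1; under eq_fun do rewrite mul1r.
by have := mq (-1); under eq_fun do rewrite mulN1r scaleNr.
Qed.

(** From $(Q\pm a)^2\ge0$, $2|Qa|\le Q^2+a^2$. The bound is linear in [E], which will be affine in
    the squared noise. *)
Lemma increment_norm_le (R : realFieldType) (eta Q a E D : R) :
  0 <= eta -> Q ^+ 2 <= E -> a ^+ 2 <= D ^+ 2 ->
  `|- (2 * eta) * (Q * a) + eta ^+ 2 * Q ^+ 2| <=
  eta * D ^+ 2 + (eta + eta ^+ 2) * E.
Proof.
move=> eta0 QE aD.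
have h2 : eta ^+ 2 * Q ^+ 2 <= eta ^+ 2 * E by rewrite ler_wpM2l ?sqr_ge0.
have h3 : eta * Q ^+ 2 <= eta * E by rewrite ler_wpM2l.
have h4 : eta * a ^+ 2 <= eta * D ^+ 2 by rewrite ler_wpM2l.
have h5 : 0 <= eta * (Q - a) ^+ 2 by rewrite mulr_ge0 ?sqr_ge0.
have h6 : 0 <= eta * (Q + a) ^+ 2 by rewrite mulr_ge0 ?sqr_ge0.
have h7 : 0 <= eta ^+ 2 * Q ^+ 2 by rewrite mulr_ge0 ?sqr_ge0.
by rewrite ler_norml; apply/andP; split; rewrite !expr2 in h2 h3 h4 h5 h6 h7 *; lra.
Qed.

Section CoordinateStep.
Variables (R : realType) (d : nat) (j l : 'I_d) (k n : nat) (Kk K1 : R -> R).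
Variables (h b L Gg Gf alpha eta : R) (S : set 'rV[R]_d) (g : 'rV[R]_d -> R).
Variable xs : 'rV[R]_d.
Hypotheses (h0 : 0 < h) (hle1 : h <= 1) (L0 : 0 <= L) (b0 : 0 <= b) (bk : 1 <= b - k%:R).
Hypotheses (hk : kernel_k n k Kk) (h1 : kernel_1 n K1) (kn : (k < n)%N).
Hypothesis gn : Cn n g.
Hypothesis gtaylor : forall x z, `|g z - taylor n g x z| <= L * enorm (z - x) `^ b.
Hypothesis gGg : forall x, fattening S x -> enorm (grad g x) <= Gg.
Hypothesis fGf : forall x, S x -> enorm (grad (pdn k j g) x) <= Gf.
Hypotheses (cS : compact S) (Sxs : S xs) (alpha0 : 0 < alpha) (eta0 : 0 <= eta).
Let RT := measurableTypeR R.

Context {dO : measure_display} {Omega : measurableType dO}.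
Variable P : probability Omega R.
Variables (G : set (set Omega)) (Z : Omega -> RT * RT).
Hypotheses (GM : G `<=` measurable) (mZ : measurable_fun setT Z).
Hypothesis indep : forall A C, measurable A -> <<s G >> C ->
  (P (Z @^-1` A `&` C) = unif2 R A * P C)%E.
Let Omega' : measurableType _ := g_sigma_algebraType G.
Variables (X : Omega -> 'rV[R]_d) (e1 e2 : Omega -> R).
Hypothesis SX : forall w, S (X w).
Hypothesis mX : forall i, measurable_fun setT ((fun w => X w 0 i) : Omega' -> R).
Hypothesis me1 : measurable_fun setT (e1 : Omega' -> R).
Hypothesis me2 : measurable_fun setT (e2 : Omega' -> R).
Hypothesis ie1 : P.-integrable setT (EFin \o (fun w => e1 w ^+ 2)).
Hypothesis ie2 : P.-integrable setT (EFin \o (fun w => e2 w ^+ 2)).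

Let q w z := kernel_estimate j l k Kk K1 h g (X w) (e1 w) (e2 w) z.
Let c w := (X w - xs) 0 l.
Let B := Cbias L Kk K1 * h `^ (b - k%:R - 1).
Let kappa := ksq Kk * ksq K1 / (4 * h ^+ (2 * k.+1)).

Let bKk : bounded_kernel Kk. Proof. by case: hk. Qed.
Let bK1 : bounded_kernel K1. Proof. by case: h1. Qed.

(** Contribution of coordinate [l] to $\|x-\eta\tilde g-x^\star\|^2-\|x-x^\star\|^2$. *)
Definition coord_increment (w : Omega) (z : RT * RT) : R :=
  - (2 * eta) * (q w z * c w) + eta ^+ 2 * q w z ^+ 2.

(** The second line is the bias after AM-GM with weight [alpha], the third the second moment. The
    gradient term stays a product, to be summed over [l] before strong monotonicity applies. *)
Definition coord_bound (w : Omega) : R :=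
  - (2 * eta) * (pd l (pdn k j g) (X w) * c w) +
  eta * (alpha * c w ^+ 2 + B ^+ 2 / alpha) +
  eta ^+ 2 * (kappa * (2 * Gg ^+ 2 + 4 * e1 w ^+ 2 + 4 * e2 w ^+ 2)).

Let mXO i : measurable_fun setT (fun w => X w 0 i).
Proof. exact: (measurable_fun_coarser GM (mX i)). Qed.

Let norm_c w : `|c w| <= diameter S.
Proof.
exact: le_trans (coord_le_enorm _ _) (enorm_le_diameter cS (SX w) Sxs).
Qed.

Lemma bddm_coord : bddm c.
Proof.
split; last by exists (diameter S).
rewrite /c; under eq_fun do rewrite !mxE.
by apply: measurable_funB => //; exact: measurable_cst.
Qed.

Lemma bddm_coord_grad : bddm (fun w => pd l (pdn k j g) (X w)).
Proof.
split; last first.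
  by exists Gf => w; apply: le_trans (pd_le_grad _ _ _) (fGf (SX w)).
by apply: measurable_comp_rV => //; exact: Cn_continuous_pd gn kn.
Qed.

Let noise_ge0 w : 0 <= 2 * Gg ^+ 2 + 4 * e1 w ^+ 2 + 4 * e2 w ^+ 2.
Proof.
by have := sqr_ge0 Gg; have := sqr_ge0 (e1 w); have := sqr_ge0 (e2 w); lra.
Qed.

Let integrable_noise : P.-integrable setT
  (EFin \o (fun w => 2 * Gg ^+ 2 + 4 * e1 w ^+ 2 + 4 * e2 w ^+ 2)).
Proof.
apply: integrableDr; last exact: integrableZr.
apply: integrableDr; last exact: integrableZr.
exact: bddm_integrable (bddm_cst _).
Qed.

Lemma integrable_coord_bound : P.-integrable setT (EFin \o coord_bound).
Proof.
have b1 : bddm (fun w => - (2 * eta) * (pd l (pdn k j g) (X w) * c w) +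
    eta * (alpha * c w ^+ 2 + B ^+ 2 / alpha)).
  apply: bddmD.
    by apply: bddmM (bddm_cst _) _; exact: bddmM bddm_coord_grad bddm_coord.
  apply: bddmM (bddm_cst _) _; apply: bddmD (bddm_cst _).
  by apply: bddmM (bddm_cst _) _; exact: bddmX bddm_coord.
exact: integrableDr (bddm_integrable P b1) (integrableZr _ (integrableZr _ integrable_noise)).
Qed.

Let bddm_coord_increment w : bddm (coord_increment w).
Proof.
have bq : bddm (q w) by exact: bddm_kernel_estimate h0 hle1 hk h1 kn gn gGg (SX w) _ _.
apply: bddmD; apply: bddmM (bddm_cst _) _; last exact: bddmX.
exact: bddmM bq (bddm_cst _).
Qed.

Lemma coord_increment_le w : \int[unif2 R]_z coord_increment w z <= coord_bound w.
Proof.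
have bq : bddm (q w) by exact: bddm_kernel_estimate h0 hle1 hk h1 kn gn gGg (SX w) _ _.
have bqc := bddmM bq (bddm_cst (c w)).
rewrite /coord_increment RintegralD//; last 2 first.
- by apply: bddm_integrable; exact: bddmM (bddm_cst _) bqc.
- by apply: bddm_integrable; exact: bddmM (bddm_cst _) (bddmX 2 bq).
rewrite (RintegralZl _ measurableT (bddm_integrable _ bqc)).
rewrite (RintegralZr _ measurableT (bddm_integrable _ bq)).
rewrite (RintegralZl _ measurableT (bddm_integrable _ (bddmX 2 bq))).
have : `|\int[unif2 R]_z q w z - pd l (pdn k j g) (X w)| <= B.
  exact: kernel_estimate_bias h0 hle1 L0 b0 hk h1 kn gn gtaylor gGg (SX w) _ _ bk.
have : \int[unif2 R]_z (q w z ^+ 2) <=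
    kappa * (2 * Gg ^+ 2 + 4 * e1 w ^+ 2 + 4 * e2 w ^+ 2).
  exact: kernel_estimate_sqr h0 hle1 hk h1 kn gn gGg (SX w) _ _.
rewrite /coord_bound.
move: (\int[unif2 R]_z (q w z ^+ 2)) (\int[unif2 R]_z q w z) (pd l _ _) (c w).
move=> Q2 Q p a hQ2 hQ.
have e20 : 0 <= eta ^+ 2 by rewrite sqr_ge0.
apply: lerD; last by rewrite ler_wpM2l.
have -> : - (2 * eta) * (Q * a) = - (2 * eta) * (p * a) + eta * (- 2 * ((Q - p) * a)) by ring.
rewrite lerD2l ler_wpM2l//.
have B0 := le_trans (normr_ge0 _) hQ.
have {hQ}hQ : (Q - p) ^+ 2 <= B ^+ 2.
  by rewrite -real_normK ?num_real// ler_sqr ?nnegrE.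
(* AM-GM: [- 2 (Q - p) a <= alpha a^2 + (Q - p)^2 / alpha] *)
have : 0 <= (alpha * a + (Q - p)) ^+ 2 / alpha by rewrite divr_ge0 ?sqr_ge0 ?ltW.
have : (Q - p) ^+ 2 / alpha <= B ^+ 2 / alpha by rewrite ler_wpM2r// invr_ge0 ltW.
move=> h3; have -> : (alpha * a + (Q - p)) ^+ 2 / alpha =
  alpha * a ^+ 2 + 2 * ((Q - p) * a) + (Q - p) ^+ 2 / alpha.
  by field; rewrite gt_eqF.
by move: h3; move: (_ / alpha) (B ^+ 2 / alpha) => E F; lra.
Qed.

(** The first factor carries the coarser sigma-algebra of the history, the form required for
    freezing. *)
Let measurable_increment : measurable_fun setT
  (fun p : Omega' * (RT * RT) => coord_increment p.1 p.2).
Proof.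
have mc : measurable_fun setT (fun p : Omega' * (RT * RT) => c p.1).
  apply: (measurableT_comp (f := c : Omega' -> R)) => //.
  rewrite /c; under eq_fun do rewrite !mxE.
  by apply: measurable_funB => //; exact: measurable_cst.
have mq : measurable_fun setT (fun p : Omega' * (RT * RT) => q p.1 p.2).
  have -> : (fun p : Omega' * (RT * RT) => q p.1 p.2) =
    (fun p => kernel_estimate j l k Kk K1 h g (X p.1) (e1 p.1) (e2 p.1) (p.2.1, p.2.2)).
    by apply/funext => -[w [u v]].
  apply: measurable_kernel_estimate => //.
  - by have [] := gn (isT : (size (@nil 'I_d) <= n)%N).
  - by move=> i; apply: (measurableT_comp (f := (fun w => X w 0 i) : Omega' -> R)).
  - exact: (measurableT_comp (f := e1 : Omega' -> R)).
  - exact: (measurableT_comp (f := e2 : Omega' -> R)).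
  - by apply: measurableT_comp; [exact: measurable_fst|exact: measurable_snd].
  - by apply: measurableT_comp; [exact: measurable_snd|exact: measurable_snd].
apply: measurable_funD; apply: measurable_funM; try exact: measurable_cst.
  exact: measurable_funM.
exact: measurable_funX.
Qed.

(** The noise is merely square integrable, so the increment need not be bounded in [w]; it is
    dominated by [N], affine in the squared noise. *)
Lemma integrable_coord_increment :
  P.-integrable setT (EFin \o (fun w => coord_increment w (Z w))).
Proof.
have [mW [M WM]] := bddm_kweight hk h1.
have D0 (w : Omega) : 0 <= diameter S := le_trans (normr_ge0 _) (norm_c w).
pose A := (2 * h ^+ k.+1) ^- 2 * M ^+ 2.
have A0 : 0 <= A by rewrite mulr_ge0 ?sqr_ge0// invr_ge0 sqr_ge0.
pose N w := eta * diameter S ^+ 2 +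
  (eta + eta ^+ 2) * (A * (2 * Gg ^+ 2 + 4 * e1 w ^+ 2 + 4 * e2 w ^+ 2)).
have iN : P.-integrable setT (EFin \o N).
  apply: integrableDr; first exact: bddm_integrable (bddm_cst _).
  by apply: integrableZr; apply: integrableZr; exact: integrable_noise.
apply: le_integrable iN => //.
  apply/measurable_EFinP.
  have mJ : measurable_fun setT (fun w : Omega => ((w : Omega'), Z w)).
    apply: measurable_fun_pair => //.
    move=> _ C mC; rewrite setTI; apply: (smallest_sub _ GM) mC.
    exact: sigma_algebra_measurable.
  exact: (measurableT_comp measurable_increment mJ).
move=> w _; rewrite /= lee_fin.
have qA : q w (Z w) ^+ 2 <= A * (2 * Gg ^+ 2 + 4 * e1 w ^+ 2 + 4 * e2 w ^+ 2).
  apply: le_trans (kernel_estimate_sqr_le j l _ _ h0 hle1 kn gn gGg (SX w) _ _ _) _.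
  rewrite /A [leRHS]mulrAC; apply: ler_wpM2l.
    by apply: mulr_ge0 (noise_ge0 w); rewrite invr_ge0 sqr_ge0.
  by rewrite -real_normK ?num_real// ler_sqr ?nnegrE// (le_trans (normr_ge0 _) (WM (Z w))).
have cD : c w ^+ 2 <= diameter S ^+ 2.
  by rewrite -real_normK ?num_real// ler_sqr ?nnegrE// (D0 w).
rewrite [leRHS]ger0_norm; last first.
  apply: addr_ge0; first by rewrite mulr_ge0 ?sqr_ge0.
  by apply: mulr_ge0; [rewrite addr_ge0 ?sqr_ge0|exact: mulr_ge0 A0 (noise_ge0 w)].
rewrite /N /coord_increment.
exact: increment_norm_le.
Qed.

Lemma Rintegral_coord_increment_le :
  \int[P]_w coord_increment w (Z w) <= \int[P]_w coord_bound w.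
Proof.
apply: (le_freezing GM mZ indep
  (H := fun p : Omega' * (RT * RT) => coord_increment p.1 p.2)).
- exact: measurable_increment.
- exact: integrable_coord_increment.
- by move=> w; exact: bddm_integrable (bddm_coord_increment w).
- exact: integrable_coord_bound.
- exact: coord_increment_le.
Qed.

End CoordinateStep.

(** * Measurability of the iterates and the recursion for the mean squared distance *)

Section Iterates.
Variables (R : realType) (d : nat) (S : set 'rV[R]_d) (g : 'rV[R]_d -> R) (j : 'I_d).
Variables (k : nat) (h : R) (eta : nat -> R) (Kk K1 : R -> R) (x0 : 'rV[R]_d).
Hypotheses (cS : compact S) (vS : convex_set S) (Sx0 : S x0).

Lemma estimatorE x (u v e1 e2 : 'I_d -> R) l :
  estimator g j k h Kk K1 x u v e1 e2 0 l =
  kernel_estimate j l k Kk K1 h g x (e1 l) (e2 l) (u l, v l).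
Proof. by rewrite mxE. Qed.

Lemma psgd_mem (Om : Type) (U V ep em : nat -> 'I_d -> Om -> R) t w :
  S (psgd S g j k h eta Kk K1 U V ep em x0 t w).
Proof.
case: t => [//|t] /=.
by have [] := proj_argmin (psgd S g j k h eta Kk K1 U V ep em x0 t w - eta t *:
  estimator g j k h Kk K1 (psgd S g j k h eta Kk K1 U V ep em x0 t w)
    (U t ^~ w) (V t ^~ w) (ep t ^~ w) (em t ^~ w)) cS (ex_intro _ _ Sx0).
Qed.

(** The sigma-algebra is left general: measurability of the iterates is needed both for the history
    and for the full space. *)
Lemma measurable_psgd (dT : measure_display) (T : measurableType dT)
    (U V ep em : nat -> 'I_d -> T -> R) t :
  bounded_kernel Kk -> bounded_kernel K1 -> continuous g ->
  (forall s l, (s < t)%N -> [/\ measurable_fun setT (U s l), measurable_fun setT (V s l),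
     measurable_fun setT (ep s l) & measurable_fun setT (em s l)]) ->
  forall i, measurable_fun setT (fun w => psgd S g j k h eta Kk K1 U V ep em x0 t w 0 i).
Proof.
move=> bKk bK1 cg; elim: t => [|t IH] mUV i; first exact: measurable_cst.
have {}IH := IH (fun s l st => mUV s l (leqW st)).
apply: (@measurable_comp_rV _ _ _ _ (fun y => Defs.proj S y 0 i)).
  move=> y; apply: (@continuous_comp _ _ _ (Defs.proj S) (fun z : 'rV[R]_d => z 0 i)).
    by apply: continuous_proj => //; exists x0.
  exact: coord_continuous.
move=> l; rewrite /=.
have [mU mV mep mem_] := mUV t l (ltnSn t).
under eq_fun do rewrite mxE [X in _ + X]mxE [X in - X]mxE estimatorE.
apply: measurable_funB; first exact: IH.
apply: measurable_funM; first exact: measurable_cst.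
exact: (measurable_kernel_estimate j l k h bKk bK1 cg IH mep mem_ mU mV).
Qed.

End Iterates.

Section StochasticStep.
Variables (R : realType) (d : nat) (j : 'I_d) (k n : nat) (Kk K1 : R -> R).
Variables (h b L Gg Gf alpha sigma : R) (eta : nat -> R) (S : set 'rV[R]_d).
Variables (g : 'rV[R]_d -> R) (xs x0 : 'rV[R]_d).
Hypotheses (h0 : 0 < h) (hle1 : h <= 1) (L0 : 0 <= L) (b0 : 0 <= b) (bk : 1 <= b - k%:R).
Hypotheses (hk : kernel_k n k Kk) (h1 : kernel_1 n K1) (kn : (k < n)%N).
Hypothesis gn : Cn n g.
Hypothesis gtaylor : forall x z, `|g z - taylor n g x z| <= L * enorm (z - x) `^ b.
Hypothesis gGg : forall x, fattening S x -> enorm (grad g x) <= Gg.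
Hypothesis fGf : forall x, S x -> enorm (grad (pdn k j g) x) <= Gf.
Hypotheses (cS : compact S) (vS : convex_set S) (Sxs : S xs) (Sx0 : S x0).
Hypotheses (alpha0 : 0 < alpha) (eta0 : forall t, 0 <= eta t).
Hypothesis mono : forall x, S x ->
  alpha * dotv (x - xs) (x - xs) <= dotv (grad (pdn k j g) x) (x - xs).
Let RT := measurableTypeR R.

Context {dO : measure_display} {Omega : measurableType dO}.
Variables (P : probability Omega R) (T : nat) (U V ep em : nat -> 'I_d -> {RV P >-> R}).
Hypothesis oracle : oracle_model T sigma U V ep em.

Let x (t : nat) (w : Omega) := psgd S g j k h eta Kk K1 U V ep em x0 t w.
Let B := Cbias L Kk K1 * h `^ (b - k%:R - 1).
Let kappa := ksq Kk * ksq K1 / (4 * h ^+ (2 * k.+1)).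

Definition mean_sq_dist (t : nat) : R := \int[P]_w dotv (x t w - xs) (x t w - xs).

(** Both summands, the indices of [U] and of [V], are cut at step [t]. All pairs of step [t] stay
    outside, so one history serves every coordinate. *)
Let past t : {set ('I_T * 'I_d) + ('I_T * 'I_d)} :=
  [set i : ('I_T * 'I_d) + ('I_T * 'I_d) |
     match i with inl p => (p.1 < t)%N | inr p => (p.1 < t)%N end].
Let G t := history (@family2 _ _ _ P T d U V) (@family2 _ _ _ P T d ep em) (past t).

Let bKk : bounded_kernel Kk. Proof. by case: hk. Qed.
Let bK1 : bounded_kernel K1. Proof. by case: h1. Qed.
Let cg : continuous g.
Proof. by have [] := gn (isT : (size (@nil 'I_d) <= n)%N). Qed.
Let Sx t w : S (x t w). Proof. exact: psgd_mem. Qed.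

Let measurable_past t s l : (s < t)%N -> (t < T)%N ->
  measurable_fun setT (U s l : g_sigma_algebraType (G t) -> R) /\
  measurable_fun setT (V s l : g_sigma_algebraType (G t) -> R).
Proof.
move=> st tT; have sT := ltn_trans st tT.
split=> _ C mC; rewrite setTI; apply: sub_sigma_algebra; left.
  by exists (inl (Ordinal sT, l)), C; rewrite inE.
by exists (inr (Ordinal sT, l)), C; rewrite inE.
Qed.

Let measurable_noise t s l : (s < T)%N ->
  measurable_fun setT (ep s l : g_sigma_algebraType (G t) -> R) /\
  measurable_fun setT (em s l : g_sigma_algebraType (G t) -> R).
Proof.
move=> sT; split=> _ C mC; rewrite setTI; apply: sub_sigma_algebra; right.
  by exists (inl (Ordinal sT, l)), C.
by exists (inr (Ordinal sT, l)), C.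
Qed.

Let GM t : G t `<=` measurable. Proof. exact: history_measurable. Qed.

Let mx t : (t < T)%N -> forall i,
  measurable_fun setT ((fun w => x t w 0 i) : g_sigma_algebraType (G t) -> R).
Proof.
move=> tT i; apply: (@measurable_psgd _ _ S g j k h eta Kk K1 x0 cS vS Sx0 _
  (g_sigma_algebraType (G t))) => // s l st.
have [mU mV] := measurable_past l st tT.
by have [mep mem_] := measurable_noise t l (ltn_trans st tT).
Qed.

Let mxO t i : measurable_fun setT (fun w => x t w 0 i).
Proof.
by apply: (@measurable_psgd _ _ S g j k h eta Kk K1 x0 cS vS Sx0 _ Omega) => // s l _; split;
  exact: measurable_funPT.
Qed.

Let bddm_sq_coord t l : bddm (fun w => (x t w - xs) 0 l ^+ 2).
Proof.
apply: bddmX; split.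
  under eq_fun do rewrite !mxE.
  by apply: measurable_funB => //; exact: measurable_cst.
exists (diameter S) => w.
exact: le_trans (coord_le_enorm _ _) (enorm_le_diameter cS (Sx t w) Sxs).
Qed.

Lemma bddm_sq_dist t : bddm (fun w => dotv (x t w - xs) (x t w - xs)).
Proof.
rewrite /dotv; apply: bddm_sum => l _; under eq_fun do rewrite -expr2.
exact: bddm_sq_coord.
Qed.

Let query_law t l : (t < T)%N -> forall A C, measurable A -> <<s G t >> C ->
  (P ((fun w => (U t l w, V t l w) : RT * RT) @^-1` A `&` C) = unif2 R A * P C)%E.
Proof.
move=> tT A C mA sC.
have [law ind _ indf] := oracle.
have [lU lV] := law t l tT.
apply: (@pair_independent _ _ _ P _ _ (@family2 _ _ _ P T d U V)
  (@family2 _ _ _ P T d ep em) ind indf (past t)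
  (inl (Ordinal tT, l)) (inr (Ordinal tT, l))) => //.
- by rewrite inE /= ltnn.
- by rewrite inE /= ltnn.
Qed.

(** A finite bound on the extended expectation of a square gives integrability, and with it a bound
    on the real integral. *)
Let noise_moment (e : {RV P >-> R}) :
  ('E_P[(fun w => e w ^+ 2)%R] <= ((sigma ^+ 2)%R)%:E)%E ->
  P.-integrable setT (EFin \o (fun w => e w ^+ 2)) /\
  \int[P]_w (e w ^+ 2) <= sigma ^+ 2.
Proof.
rewrite unlock => He.
have me : measurable_fun setT (EFin \o (fun w => e w ^+ 2)).
  by apply/measurable_EFinP; apply: measurable_funX; exact: measurable_funPT.
have ie : P.-integrable setT (EFin \o (fun w => e w ^+ 2)).
  apply/integrableP; split => //; apply: le_lt_trans (le_lt_trans He (ltry _)).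
  rewrite le_eqVlt; apply/orP; left; apply/eqP; apply: eq_integral => w _ /=.
  by rewrite ger0_norm// sqr_ge0.
split => //; rewrite -lee_fin /Rintegral fineK//; exact: integrable_fin_num ie.
Qed.

Lemma mean_sq_dist_step t : (t < T)%N ->
  mean_sq_dist t.+1 <= (1 - eta t * alpha) * mean_sq_dist t +
    eta t * (d%:R * (B ^+ 2 / alpha)) +
    eta t ^+ 2 * (d%:R * (kappa * (2 * Gg ^+ 2 + 8 * sigma ^+ 2))).
Proof.
move=> tT.
have [_ _ /(_ t _ tT) nz _] := oracle.
have nep l := noise_moment (nz l).1; have nem l := noise_moment (nz l).2.
pose Z l w : RT * RT := (U t l w, V t l w).
have mZ l : measurable_fun setT (Z l).
  by apply: measurable_fun_pair;
    [exact (measurable_funPT (U t l))|exact (measurable_funPT (V t l))].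
pose inc l w := coord_increment j l k Kk K1 h (eta t) g xs (x t) (ep t l) (em t l) w (Z l w).
pose bnd l w := coord_bound j l k Kk K1 h b L Gg alpha (eta t) g xs (x t) (ep t l) (em t l) w.
have [me1 me2] : (forall l, measurable_fun setT (ep t l : g_sigma_algebraType (G t) -> R)) /\
    (forall l, measurable_fun setT (em t l : g_sigma_algebraType (G t) -> R)).
  by split => l; have [] := measurable_noise t l tT.
have iinc l : P.-integrable setT (EFin \o inc l).
  exact: (integrable_coord_increment j l h0 hle1 hk h1 kn gn gGg cS Sxs (eta0 t) (@GM t)
    (mZ l) (Sx t) (mx tT) (me1 l) (me2 l) (nep l).1 (nem l).1).
have ibnd l : P.-integrable setT (EFin \o bnd l).
  exact: (integrable_coord_bound l Kk K1 h b L Gg alpha (eta t) kn gn fGf cS Sxs (@GM t)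
    (Sx t) (mx tT) (nep l).1 (nem l).1).
have inc_bnd l : \int[P]_w inc l w <= \int[P]_w bnd l w.
  exact: (Rintegral_coord_increment_le l h0 hle1 L0 b0 bk hk h1 kn gn gtaylor gGg fGf cS
    Sxs alpha0 (eta0 t) (@GM t) (mZ l) (query_law l tT) (Sx t) (mx tT) (me1 l) (me2 l)
    (nep l).1 (nem l).1).
have iD s := bddm_integrable P (bddm_sq_dist s).
have isum := integrable_sumr (index_enum 'I_d) (p := xpredT) (fun l _ => iinc l).
(* Contraction removes the projection; the squared norm then expands into one increment per
   coordinate, each involving a single pair. *)
apply: le_trans (_ : mean_sq_dist t + \sum_l \int[P]_w inc l w <= _).
  rewrite /mean_sq_dist -(Rintegral_sum (index_enum 'I_d) (fun l (_ : xpredT l) => iinc l))//.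
  rewrite -RintegralD//; apply: le_Rintegral => //; first exact: integrableDr.
  move=> w _.
  have -> : x t.+1 w = Defs.proj S (x t w - eta t *: estimator g j k h Kk K1 (x t w)
    (U t ^~ w) (V t ^~ w) (ep t ^~ w) (em t ^~ w)) by [].
  apply: le_trans (proj_contract _ cS vS Sxs) _.
  rewrite /inc /coord_increment /Z; under eq_bigr => l _ do rewrite -[kernel_estimate _ _ _ _ _ _ _
    _ _ _ _](estimatorE g j k h Kk K1 (x t w) (U t ^~ w) (V t ^~ w) (ep t ^~ w) (em t ^~ w)).
  move: (estimator _ _ _ _ _ _ _ _ _ _ _) => e; move: (x t w) => y.
  have -> : y - eta t *: e - xs = (y - xs) - eta t *: e by exact: addrAC.
  rewrite (dotvBB (y - xs)) !dotvZr !dotvZl -addrA lerD2l /dotv !mulr_sumr.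
  rewrite -sumrN -big_split/= le_eqVlt; apply/orP; left; apply/eqP; apply: eq_bigr => l _.
  by move: (e 0 l) ((y - xs) 0 l) => q c; ring.
(* What remains of [bnd] once the gradient term and the term in $\alpha c^2$ are taken out. *)
pose bnd' l w := eta t * (B ^+ 2 / alpha) +
  eta t ^+ 2 * (kappa * (2 * Gg ^+ 2 + 4 * ep t l w ^+ 2 + 4 * em t l w ^+ 2)).
have ibnd' l : P.-integrable setT (EFin \o bnd' l).
  apply: integrableDr; first exact: bddm_integrable (bddm_cst _).
  apply: integrableZr; apply: integrableZr; apply: integrableDr; last first.
    by apply: integrableZr; exact: (nem l).1.
  apply: integrableDr; first exact: bddm_integrable (bddm_cst _).
  by apply: integrableZr; exact: (nep l).1.
have kappa0 : 0 <= kappa.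
  rewrite /kappa divr_ge0 ?mulr_ge0 ?ksq_ge0//.
  by rewrite exprn_ge0// ltW.
have Ibnd' l : \int[P]_w bnd' l w <= eta t * (B ^+ 2 / alpha) +
    eta t ^+ 2 * (kappa * (2 * Gg ^+ 2 + 8 * sigma ^+ 2)).
  have [ip Hp] := nep l; have [im Hm] := nem l.
  have i1 : P.-integrable setT (EFin \o (fun w => 4 * ep t l w ^+ 2)) by exact: integrableZr.
  have i2 : P.-integrable setT (EFin \o (fun w => 4 * em t l w ^+ 2)) by exact: integrableZr.
  have ic (a : R) : P.-integrable setT (EFin \o (fun=> a)).
    exact: bddm_integrable (bddm_cst _).
  have i3 := integrableDr (ic (2 * Gg ^+ 2)) i1.
  have i4 := integrableDr i3 i2.
  have i5 := integrableZr kappa i4.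
  have P1 : fine (P setT) = 1 by rewrite probability_setT.
  rewrite (RintegralD measurableT (ic _) (integrableZr _ i5)).
  rewrite (RintegralZl _ measurableT i5) (RintegralZl _ measurableT i4).
  rewrite (RintegralD measurableT i3 i2) (RintegralD measurableT (ic _) i1).
  rewrite (RintegralZl _ measurableT ip) (RintegralZl _ measurableT im).
  rewrite !Rintegral_cst// P1 !mulr1 lerD2l ler_wpM2l ?sqr_ge0// ler_wpM2l//.
  by move: Hp Hm; move: (Rintegral _ _ _) (Rintegral _ _ _) => u v; lra.
(* Strong monotonicity yields $-2\eta_t\alpha$, half of which is spent on the $+\eta_t\alpha$ left
   by AM-GM. *)
apply: le_trans (_ : mean_sq_dist t + \int[P]_w (- (eta t * alpha) *
    dotv (x t w - xs) (x t w - xs) + \sum_l bnd' l w) <= _).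
  rewrite lerD2l; apply: le_trans (ler_sum _ (fun l _ => inc_bnd l)) _.
  rewrite -(Rintegral_sum (index_enum 'I_d) (fun l (_ : xpredT l) => ibnd l))//.
  apply: le_Rintegral => //.
  - exact: integrable_sumr.
  - by apply: integrableDr; [exact: integrableZr|exact: integrable_sumr].
  move=> w _.
  have -> : \sum_l bnd l w = - (2 * eta t) * dotv (grad (pdn k j g) (x t w)) (x t w - xs) +
     eta t * alpha * dotv (x t w - xs) (x t w - xs) + \sum_l bnd' l w.
    rewrite /dotv !mulr_sumr -!big_split/=; apply: eq_bigr => l _.
    rewrite /bnd /coord_bound /bnd' -/B -/kappa [grad _ _ _ _]mxE.
    move: (pd l _ _) ((x t w - xs) 0 l) (kappa * _) (B ^+ 2 / alpha) => p q u v; ring.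
  rewrite lerD2r; have := mono (Sx t w).
  move: (dotv _ _) (dotv _ _) (eta0 t) => A D; move: (eta t) => et et0 AD.
  have := ler_wpM2l et0 AD; lra.
rewrite RintegralD//; [|exact: integrableZr|exact: integrable_sumr].
rewrite RintegralZl// -/(mean_sq_dist t).
rewrite (Rintegral_sum (index_enum 'I_d) (fun l (_ : xpredT l) => ibnd' l))//.
have : \sum_l \int[P]_w bnd' l w <= \sum_(l < d) (eta t * (B ^+ 2 / alpha) +
    eta t ^+ 2 * (kappa * (2 * Gg ^+ 2 + 8 * sigma ^+ 2))).
  by apply: ler_sum => l _; exact: Ibnd'.
rewrite sumr_const card_ord -[X in _ <= X]mulr_natl.
move: (\sum_l _) (mean_sq_dist t) (B ^+ 2 / alpha) (kappa * _) (d%:R : R) (eta t).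
by move=> s D u v dd et; lra.
Qed.

Lemma mean_sq_dist0_le : mean_sq_dist 0 <= diameter S ^+ 2.
Proof.
rewrite /mean_sq_dist /x [X in X <= _](Rintegral_cst P measurableT (dotv (x0 - xs) (x0 - xs))).
have -> : fine (P setT) = 1 by rewrite probability_setT.
rewrite mulr1 -enorm_sqr.
have xD := enorm_le_diameter cS Sx0 Sxs.
by rewrite ler_sqr ?nnegrE ?enorm_ge0// (le_trans (enorm_ge0 _) xD).
Qed.

(** Nonnegativity of the gap lets extended integrals be compared directly; [m] will be the minimum
    value. *)
Lemma mean_gap_le t (m Lf : R) :
  (forall y, S y -> 0 <= pdn k j g y - m <= Lf * dotv (y - xs) (y - xs)) ->
  ('E_P[fun w => (pdn k j g (x t w) - m)%R] <= (Lf * mean_sq_dist t)%:E)%E.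
Proof.
move=> gap; have iD := bddm_integrable P (bddm_sq_dist t).
have iL := integrableZr Lf iD.
have -> : (Lf * mean_sq_dist t)%:E =
    (\int[P]_w (Lf * dotv (x t w - xs) (x t w - xs))%:E)%E.
  rewrite -(RintegralZl _ measurableT iD) /Rintegral fineK//.
  exact: integrable_fin_num iL.
rewrite unlock; apply: ge0_le_integral => //.
- by move=> w _; rewrite lee_fin; have /andP[] := gap _ (Sx t w).
- apply/measurable_EFinP/measurable_funB; last exact: measurable_cst.
  by apply: measurable_comp_rV => //; exact (Cn_pdn_continuous gn (ltnW kn)).
- exact: measurable_int iL.
- by move=> w _; rewrite lee_fin; have /andP[] := gap _ (Sx t w).
Qed.

End StochasticStep.

(** * Convergence rate *)

(** The value $b/\alpha$ is a fixed point of $D\mapsto(1-\eta\alpha)D+\eta b$, so only the part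
    $Q/(t+t_0)$ has to decay. The summand $t_0D_2$ of $Q$ is fixed by the start $t=0$, and
    $\gamma^2v$ absorbs the variance. *)
Lemma robbins_monro_recursion (R : realType) (alpha gamma t0 b v D2 : R) (D : nat -> R) (T : nat) :
  0 < alpha -> 4 / alpha <= gamma -> alpha * gamma <= t0 ->
  0 <= b -> 0 <= v -> 0 <= D2 -> D 0%N <= D2 ->
  (forall t, (t < T)%N -> D t.+1 <= (1 - step_size gamma t0 t * alpha) * D t +
     step_size gamma t0 t * b + step_size gamma t0 t ^+ 2 * v) ->
  D T <= b / alpha + (t0 * D2 + gamma ^+ 2 * v) / (T%:R + t0).
Proof.
move=> alpha0 gamma4 t0ag b0 v0 D20 D0 rec.
have a4 : 4 <= alpha * gamma by move: gamma4; rewrite ler_pdivrMr// mulrC.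
have t00 : 0 < t0 by lra.
suff : forall t, (t <= T)%N ->
    D t <= b / alpha + (t0 * D2 + gamma ^+ 2 * v) / (t%:R + t0) by exact.
elim=> [_|t IH tT].
  rewrite add0r mulrDl mulrAC divff ?gt_eqF// mul1r.
    apply: le_trans D0 _; rewrite addrCA lerDl.
  by rewrite addr_ge0 ?(divr_ge0 _ (ltW alpha0))// (divr_ge0 _ (ltW t00))// mulr_ge0 ?sqr_ge0.
apply: le_trans (rec t tT) _; rewrite /step_size.
have {}IH := IH (ltnW tT).
have s0 : t0 <= t%:R + t0 :> R by rewrite lerDr.
rewrite -natr1 (addrAC t%:R).
move: (t%:R + t0) s0 IH => s s0 IH.
set Q := t0 * D2 + gamma ^+ 2 * v in IH *.
have sp : 0 < s by lra.
(* Here $s\ge t_0\ge\alpha\gamma$, so the induction hypothesis may be multiplied by the contraction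
   factor. *)
have c0 : 0 <= 1 - gamma / s * alpha.
  by rewrite subr_ge0 mulrAC ler_pdivrMr// mul1r; lra.
have hQ : gamma ^+ 2 * v <= Q by rewrite lerDr mulr_ge0// ltW.
have Q0 : 0 <= Q by apply: le_trans hQ; rewrite mulr_ge0 ?sqr_ge0.
have h1 := ler_wpM2l c0 IH.
apply: le_trans (_ : (1 - gamma / s * alpha) * (b / alpha + Q / s) + gamma / s * b +
   (gamma / s) ^+ 2 * v <= _); first by rewrite !lerD2r.
have -> : (1 - gamma / s * alpha) * (b / alpha + Q / s) + gamma / s * b + (gamma / s) ^+ 2 * v =
  b / alpha + (Q / s + (gamma ^+ 2 * v - alpha * gamma * Q) / s ^+ 2).
  by field; rewrite !gt_eqF.
rewrite lerD2l -subr_ge0.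
have -> : Q / (s + 1) - (Q / s + (gamma ^+ 2 * v - alpha * gamma * Q) / s ^+ 2) =
  ((alpha * gamma * Q - gamma ^+ 2 * v) * (s + 1) - Q * s) / ((s + 1) * s ^+ 2).
  by field; rewrite !gt_eqF//; lra.
rewrite divr_ge0//; last by rewrite mulr_ge0 ?sqr_ge0//; lra.
(* By $\alpha\gamma\ge4$ and $\gamma^2v\le Q$ the right side is at least $3Q$. *)
have : Q <= alpha * gamma * Q - gamma ^+ 2 * v.
  have := ler_wpM2r Q0 a4; lra.
move/(ler_wpM2r (ltW sp)).
have : 0 <= alpha * gamma * Q - gamma ^+ 2 * v by have := ler_wpM2r Q0 a4; lra.
move: (_ - gamma ^+ 2 * v) => w; lra.
Qed.

(** * Consequences of the choice of bandwidth *)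

Section Bandwidth.
Variables (R : realType) (kappa beta : R) (k T : nat).
Hypotheses (kappa0 : 0 < kappa) (beta2 : 2 <= beta) (T1 : (1 <= T)%N).
Let p := beta + k%:R.
Let h := bandwidth kappa beta k T.
Let rate : R := T%:R `^ (- ((beta - 1) / p)).

Let p0 : 0 < p. Proof. by rewrite ltr_wpDr//; move: beta2; lra. Qed.
Let TR1 : 1 <= T%:R :> R. Proof. by rewrite ler1n. Qed.
Let TR0 : 0 < T%:R :> R. Proof. exact: lt_le_trans TR1. Qed.

Lemma bandwidth_gt0 : 0 < h.
Proof. by rewrite lt_min ltr01 andbT mulr_gt0// powR_gt0. Qed.

Lemma bandwidth_le1 : h <= 1.
Proof. by rewrite ge_min lexx orbT. Qed.

Lemma inv_le_rate : T%:R^-1 <= rate.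
Proof.
rewrite -powR_inv1 ?ler0n// ler_powR// lerN2 ler_pdivrMr// mul1r.
by rewrite lerD// (le_trans _ (ler0n _ k))// lerN10.
Qed.

(** Only $h\le\kappa T^{-1/(2p)}$ is used; the power $2(\beta-1)$ of $T^{-1/(2p)}$ is exactly the
    rate. *)
Lemma bandwidth_bias : (h `^ (beta - 1)) ^+ 2 <= (kappa `^ (beta - 1)) ^+ 2 * rate.
Proof.
have -> : rate = ((T%:R `^ (- (2 * p)^-1)) `^ (beta - 1)) ^+ 2.
  rewrite -powR_mulrn ?powR_ge0// -!powRrM; congr (_ `^ _).
  by field; rewrite gt_eqF.
have kT : 0 < kappa * T%:R `^ (- (2 * p)^-1) by rewrite mulr_gt0 ?powR_gt0.
rewrite -exprMn -(powRM _ (ltW kappa0) (powR_ge0 _ _)) ler_sqr ?nnegrE ?powR_ge0//.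
apply: ge0_ler_powR; rewrite ?nnegrE ?(ltW kT) ?(ltW bandwidth_gt0)//.
  by move: beta2; lra.
by rewrite ge_min lexx.
Qed.

(** If the minimum is $\kappa T^{-1/(2p)}$, the exponent of $T$ is $(k+1)/p-1=-(\beta-1)/p$.
    Otherwise $h=1$ and $1/T$ is below the rate. The constant covers both cases. *)
Lemma bandwidth_variance :
  h ^- (2 * k.+1) / T%:R <= (1 + kappa ^- (2 * k.+1)) * rate.
Proof.
have r0 : 0 <= rate by exact: powR_ge0.
have [hle|hle] := leP (kappa * T%:R `^ (- (2 * p)^-1)) 1.
  have -> : h = kappa * T%:R `^ (- (2 * p)^-1) by rewrite /h /bandwidth min_l.
  rewrite exprMn -(powR_mulrn _ (powR_ge0 T%:R _)) -powRrM invfM -powRN -mulrA.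
  rewrite -(powR_inv1 (ltW TR0)) -powRD; last by apply/implyP => _; rewrite gt_eqF.
  rewrite (_ : _ + _ = - ((beta - 1) / p)).
    by rewrite -/rate [X in _ <= X]mulrDl mul1r lerDr.
  rewrite /p natrM -natr1; field.
  by rewrite gt_eqF.
have -> : h = 1 by rewrite /h /bandwidth min_r// ltW.
rewrite expr1n invr1 mul1r mulrDl mul1r; apply: le_trans inv_le_rate _.
by rewrite lerDl mulr_ge0// invr_ge0 exprn_ge0 ?ltW.
Qed.

(** The exponents of $d$ add up to $(2\beta+k-1-(\beta-1))/p=1$, the linear dependence on $d$ of the
    bound in terms of $T$. *)
Lemma query_rate (d : nat) : (0 < d)%N ->
  d%:R `^ ((2 * beta + k%:R - 1) / p) * (2 * d * T)%:R `^ (- ((beta - 1) / p)) =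
  2 `^ (- ((beta - 1) / p)) * (d%:R * rate).
Proof.
move=> d0; have d0R : 0 < d%:R :> R by rewrite ltr0n.
rewrite !natrM !powRM ?mulr_ge0//.
rewrite -(mulrA (2 `^ _)) mulrCA; congr (_ * _); rewrite mulrA; congr (_ * _).
rewrite -powRD; last by apply/implyP => _; rewrite gt_eqF.
rewrite -[RHS]powRr1 ?ler0n//; congr (_ `^ _).
by rewrite /p; field; rewrite gt_eqF.
Qed.

End Bandwidth.

(** Here [dd] is the dimension, [r] the rate, [Bh] is $h^{\beta-1}$, [hv] is $h^{-2(k+1)}$, and
    [Kb], [Kv] are the powers of $\kappa$. The initial term is free of the dimension and is enlarged
    by the factor [dd]. *)
Lemma rate_assembly (R : realFieldType)
    (alpha gamma t0 D2 Lf dd r T Cb Cv Bh Kb hv Kv v : R) :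
  0 < alpha -> 0 <= Lf -> 0 <= t0 -> 0 <= D2 -> 1 <= dd -> 0 < T -> 0 <= Cv ->
  0 <= v -> v <= Cv * hv ->
  Bh ^+ 2 <= Kb * r -> hv / T <= (1 + Kv) * r -> T^-1 <= r ->
  Lf * (dd * ((Cb * Bh) ^+ 2 / alpha) / alpha + (t0 * D2 + gamma ^+ 2 * (dd * v)) / (T + t0)) <=
  Lf * (Cb ^+ 2 * Kb / alpha ^+ 2 + t0 * D2 + gamma ^+ 2 * (Cv * (1 + Kv))) * (dd * r).
Proof.
move=> a0 Lf0 t00 D20 dd1 T0 Cv0 v0 hv1 hB hV hT.
have dd0 : 0 <= dd by lra.
have r0 : 0 <= r by apply: le_trans hT; rewrite invr_ge0 ltW.
rewrite -[leRHS]mulrA ler_wpM2l// !(mulrDl _ _ (dd * r)) -[leRHS]addrA; apply: lerD.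
  have -> : dd * ((Cb * Bh) ^+ 2 / alpha) / alpha = Cb ^+ 2 / alpha ^+ 2 * dd * Bh ^+ 2.
    by field; rewrite gt_eqF.
  have -> : Cb ^+ 2 * Kb / alpha ^+ 2 * (dd * r) = Cb ^+ 2 / alpha ^+ 2 * dd * (Kb * r) by ring.
  by rewrite ler_wpM2l// mulr_ge0// divr_ge0 ?sqr_ge0.
have N0 : 0 <= t0 * D2 + gamma ^+ 2 * (dd * v).
  by rewrite addr_ge0// mulr_ge0// ?sqr_ge0// mulr_ge0.
apply: le_trans (_ : (t0 * D2 + gamma ^+ 2 * (dd * v)) / T <= _).
  by rewrite ler_wpM2l// lef_pV2 ?posrE// ?lerDl// ltr_wpDr.
rewrite mulrDl; apply: lerD.
  rewrite ler_wpM2l ?mulr_ge0//; apply: le_trans hT _.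
  by rewrite -[leLHS]mul1r ler_wpM2r.
have -> : gamma ^+ 2 * (dd * v) / T = gamma ^+ 2 * dd * (v / T) by ring.
have -> : gamma ^+ 2 * (Cv * (1 + Kv)) * (dd * r) = gamma ^+ 2 * dd * (Cv * ((1 + Kv) * r)).
  by ring.
rewrite ler_wpM2l//; first by rewrite mulr_ge0 ?sqr_ge0.
apply: le_trans (ler_wpM2l Cv0 hV); rewrite mulrA ler_wpM2r//.
by rewrite invr_ge0 ltW.
Qed.

(** The three summands come from the squared bias, the initial distance and the variance. *)
Definition rate_constant (R : realType) (beta : R) (k : nat)
    (alpha gamma t0 kappa Lf D Cb Cv : R) : R :=
  Lf * (Cb ^+ 2 * (kappa `^ (beta - 1)) ^+ 2 / alpha ^+ 2 + t0 * D ^+ 2 +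
    gamma ^+ 2 * (Cv * (1 + kappa ^- (2 * k.+1)))).

Lemma Cvar_ge0 (R : realType) (Lbar Gg sigma : R) (Kk K1 : R -> R) :
  0 <= Cvar Lbar Gg sigma Kk K1.
Proof.
apply: mulr_ge0; first by rewrite divr_ge0// mulr_ge0 ?ksq_ge0.
by rewrite !addr_ge0// ?divr_ge0// mulr_ge0// sqr_ge0.
Qed.

Lemma rate_constant_ge0 (R : realType) (beta : R) (k : nat)
    (alpha gamma t0 kappa Lf D Cb Cv : R) :
  0 <= Lf -> 0 <= t0 -> 0 <= kappa -> 0 <= Cv ->
  0 <= rate_constant beta k alpha gamma t0 kappa Lf D Cb Cv.
Proof.
move=> Lf0 t00 kappa0 Cv0; apply: mulr_ge0 => //; apply: addr_ge0; first apply: addr_ge0.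
- by apply: divr_ge0; [apply: mulr_ge0|]; exact: sqr_ge0.
- by apply: mulr_ge0 => //; exact: sqr_ge0.
- apply: mulr_ge0; first exact: sqr_ge0.
  by apply: mulr_ge0 => //; rewrite addr_ge0// invr_ge0 exprn_ge0.
Qed.

Lemma expected_gap_le (R : realType) (beta : R) (k : nat)
    (alpha gamma t0 kappa L Lf G Gg Lbar sigma : R)
    (d : nat) (j : 'I_d) (Theta : set 'rV[R]_d) (Kk K1 : R -> R) (T : nat)
    (dO : measure_display) (Omega : measurableType dO)
    (P : probability Omega R) (U V ep em : nat -> 'I_d -> {RV P >-> R})
    (x0 : 'rV[R]_d) (g : 'rV[R]_d -> R) :
  let h := bandwidth kappa beta k T in
  let f := pdn k j g in
  2 <= beta -> 0 < alpha -> 0 < L -> 0 < Lf -> 0 < kappa ->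
  4 / alpha <= gamma -> alpha * gamma <= t0 -> compact Theta -> convex_set Theta ->
  kernel_k (sfloor (beta + k%:R)) k Kk -> kernel_1 (sfloor (beta + k%:R)) K1 ->
  (1 <= T)%N -> oracle_model T sigma U V ep em -> Theta x0 ->
  fclass Theta j alpha beta k L Lf G Gg Lbar g ->
  ('E_P[fun w => (f (psgd Theta g j k h (step_size gamma t0) Kk K1 U V ep em x0 T w)
      - f (argmin f Theta))%R] <=
   (rate_constant beta k alpha gamma t0 kappa Lf (diameter Theta)
      (Cbias L Kk K1) (Cvar Lbar Gg sigma Kk K1) *
    (d%:R * T%:R `^ (- ((beta - 1) / (beta + k%:R))))%R)%:E)%E.
Proof.
move=> h f beta2 a0 L0 Lf0 kappa0 gamma4 t0ag cS vS hk h1 T1 oracle Sx0.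
case=> -[gn gtaylor] sc lip fGf gGg _ [xs ixs xsmin].
have Sxs : Theta xs by exact: nbhs_singleton ixs.
have p0 : 0 < beta + k%:R by rewrite ltr_wpDr//; lra.
(* By [sfloorP], [sfloor] plus one is at least $\beta+k>k+1$, so one derivative beyond
   $\partial_j^k$ is available. *)
have kn : (k < sfloor (beta + k%:R))%N.
  rewrite -ltnS -(ltr_nat R); have /andP[_] := sfloorP p0; apply: lt_le_trans.
  by rewrite -natr1 addrC ltrD2r; lra.
have [h0 hle1] := (bandwidth_gt0 beta k kappa0 T1, bandwidth_le1 kappa beta k T).
have gm0 : 0 < gamma by apply: lt_le_trans gamma4; rewrite divr_gt0.
have t00 : 0 < t0 by apply: lt_le_trans t0ag; rewrite mulr_gt0.
have eta0 t : 0 <= step_size gamma t0 t.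
  by rewrite divr_ge0 ?(ltW gm0)// addr_ge0// ltW.
(* Comparing values is enough: the chosen minimizer and the interior one need not be identified as
   points. *)
have fmin : f (argmin f Theta) = f xs.
  have [Sa amin] : Theta (argmin f Theta) /\ forall y, Theta y -> f (argmin f Theta) <= f y.
    by apply: argminP; exists xs.
  by apply/eqP; rewrite eq_le amin//= xsmin.
have bk : 1 <= beta + k%:R - k%:R :> R by rewrite addrK; lra.
have step := mean_sq_dist_step h0 hle1 (ltW L0) (ltW p0) bk hk h1 kn gn gtaylor gGg fGf cS vS
  Sxs Sx0 a0 eta0 (grad_monotone a0 Lf0 sc lip ixs xsmin) oracle.
apply: le_trans (mean_gap_le h (step_size gamma t0) hk h1 kn gn cS vS Sxs Sx0 U V ep em T _) _.
  move=> y Sy; rewrite fmin subr_ge0 xsmin//=.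
  exact: (suboptimality_le a0 Lf0 sc lip ixs xsmin Sy).
have kq0 : 0 <= ksq Kk * ksq K1 by rewrite mulr_ge0 ?ksq_ge0.
have hp : 0 < h ^+ (2 * k.+1) by rewrite exprn_gt0.
have v0 : 0 <= ksq Kk * ksq K1 / (4 * h ^+ (2 * k.+1)) * (2 * Gg ^+ 2 + 8 * sigma ^+ 2).
  apply: mulr_ge0; first by apply: divr_ge0 => //; rewrite mulr_ge0// ltW.
  by rewrite addr_ge0// mulr_ge0// sqr_ge0.
rewrite lee_fin; apply: le_trans (ler_wpM2l (ltW Lf0) (robbins_monro_recursion a0 gamma4 t0ag
  _ _ (sqr_ge0 (diameter Theta)) (mean_sq_dist0_le _ _ _ _ _ _ _ cS Sxs Sx0 _ _ _ _) step)) _.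
- by rewrite mulr_ge0// divr_ge0 ?sqr_ge0// ltW.
- by rewrite mulr_ge0.
rewrite addrK; apply: (@rate_assembly _ _ _ _ _ _ _ _ _ _ _ _ _ (h ^- (2 * k.+1))) => //.
- exact: ltW.
- exact: ltW.
- exact: sqr_ge0.
- by rewrite ler1n (leq_ltn_trans (leq0n j) (ltn_ord j)).
- by rewrite ltr0n.
- exact: Cvar_ge0.
(* The bracket of [Cvar] dominates $2G_g^2+8\sigma^2$. *)
- rewrite /Cvar; move: kq0 hp; rewrite /h; move: (ksq Kk * ksq K1) (_ ^+ (2 * k.+1)) => q H q0 H0.
  have -> : q / (4 * H) * (2 * Gg ^+ 2 + 8 * sigma ^+ 2) =
      q / 4 * (2 * Gg ^+ 2 + 8 * sigma ^+ 2) / H by field; rewrite gt_eqF.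
  rewrite ler_wpM2r// ?invr_ge0 ?(ltW H0)// ler_wpM2l ?divr_ge0//.
  by have := sqr_ge0 Lbar; have := sqr_ge0 Gg; lra.
- exact: bandwidth_bias.
- exact: bandwidth_variance.
- exact: inv_le_rate.
Qed.

(** [C] is chosen right after [beta] and [k], before the dimension, the horizon, the kernels and the
    probability space; this order of quantifiers expresses the independence of $N$ and $d$. *)
Theorem theorem5p1 (R : realType) (beta : R) (k : nat) (hbeta : 2 <= beta) :
  exists C : R -> R -> R -> R -> R -> R -> R -> R -> R -> R,
  forall (alpha gamma t0 kappa L Lf G Gg Lbar sigma : R)
    (d : nat) (j : 'I_d) (Theta : set 'rV[R]_d) (Kk K1 : R -> R) (T : nat)
    (dO : measure_display) (Omega : measurableType dO)
    (P : probability Omega R) (U V ep em : nat -> 'I_d -> {RV P >-> R})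
    (x0 : 'rV[R]_d),
  0 < alpha -> 0 < L -> 0 < Lf -> 0 < G -> 0 < Gg -> 0 < Lbar ->
  0 <= sigma -> 0 < kappa -> 4 / alpha <= gamma -> alpha * gamma <= t0 ->
  compact Theta -> convex_set Theta -> interior Theta !=set0 ->
  kernel_k (sfloor (beta + k%:R)) k Kk ->
  kernel_1 (sfloor (beta + k%:R)) K1 ->
  (1 <= T)%N ->
  oracle_model T sigma U V ep em ->
  Theta x0 ->
  let h := bandwidth kappa beta k T in
  let N := (2 * d * T)%N in
  let f g := pdn k j g in
  let x g := psgd Theta g j k h (step_size gamma t0) Kk K1 U V ep em x0 in
  let c := C alpha gamma t0 kappa Lf G (diameter Theta)
             (Cbias L Kk K1) (Cvar Lbar Gg sigma Kk K1) in
  0 < c /\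
  (ereal_sup
     [set 'E_P[(fun w => f g (x g T w) - f g (argmin (f g) Theta))%R]
       | g in fclass Theta j alpha beta k L Lf G Gg Lbar]
   <= (c * d%:R `^ ((2 * beta + k%:R - 1) / (beta + k%:R))
         * N%:R `^ (- ((beta - 1) / (beta + k%:R))))%R%:E)%E.

Proof.
(* The summand 1 makes the constant positive when [Cb] and [Cv] vanish. *)
exists (fun alpha gamma t0 kappa Lf G D Cb Cv =>
  2 `^ ((beta - 1) / (beta + k%:R)) * rate_constant beta k alpha gamma t0 kappa Lf D Cb Cv + 1).
move=> alpha gamma t0 kappa L Lf G Gg Lbar sigma d j Theta Kk K1 T dO Omega P U V ep em x0.
move=> a0 L0 Lf0 G0 Gg0 Lbar0 sigma0 kappa0 gamma4 t0ag cS vS _ hk h1 T1 oracle Sx0 h N f x c.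
have gm0 : 0 < gamma by apply: lt_le_trans gamma4; rewrite divr_gt0.
have t00 : 0 < t0 by apply: lt_le_trans t0ag; rewrite mulr_gt0.
have c0 : 0 < c.
  rewrite ltr_wpDl// mulr_ge0 ?powR_ge0//.
  by apply: rate_constant_ge0; rewrite ?Cvar_ge0// ltW.
split=> //; apply: ge_ereal_sup => _ [g gF <-].
apply: le_trans (expected_gap_le hbeta a0 L0 Lf0 kappa0 gamma4 t0ag cS vS hk h1 T1 oracle Sx0 gF) _.
rewrite lee_fin /N -mulrA query_rate//; last exact: leq_ltn_trans (leq0n j) (ltn_ord j).
rewrite [leRHS]mulrA; apply: ler_wpM2r; first by rewrite mulr_ge0 ?powR_ge0.
(* The power of 2 in the constant cancels the one that $N=2dT$ leaves in [query_rate]. *)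
rewrite /c mulrDl mul1r mulrAC powRN divff ?gt_eqF ?powR_gt0// mul1r.
by rewrite lerDl invr_ge0 powR_ge0.
Qed.
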